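(* Let $k\ge2$ be an integer and let $H=((V,\mathcal A,\mu),E)$ be a $k$-uniform measurable hypergraph, where $V$ is a compact Hausdorff space and $\mu$ is a finite Borel measure on $V$. Then, for every integer $r\ge1$, $$\mathrm M_{k+r}(H)\le \mathrm{blockM}_{k+r+1}(H)\le \vartheta_{\mathrm{small}}(H,C_r(V,k)^*_{\mathrm c})^{1/(k-1)}$$ and $$\mathrm M_{k+r}(H)\le \mathrm{blockM}_{k+r+1}(H)\le \vartheta_{\mathrm{big}}(H,C_r(V,k)^*_{\mathrm c}).$$
   Context: All functions and measures are real valued. A $k$-uniform measurable hypergraph has as edges $k$-element subsets of $V$, with $E$ identified with the symmetric set of tuples $(v_1,\dots,v_k)\in V^k$ with $\{v_1,\dots,v_k\}$ an edge, required to be measurable. A set is independent if it contains no edge. Subset spaces: for $r\ge0$, $\mathrm{Sub}_r(V)$ is the set of all subsets of $V$ of cardinality at most $r$, including $\emptyset$. $\mathrm{Sub}_r(V)\setminus\{\emptyset\}$ has the quotient topology under $V^r\to \mathrm{Sub}_r(V)$, $(v_1,\dots,v_r)\mapsto\{v_1,\dots,v_r\}$, and $\mathrm{Sub}_r(V)$ is the disjoint union of this space and the point $\emptyset$. $\mathcal I_r\subseteq\mathrm{Sub}_r(V)$ denotes the set of independent sets of cardinality at most $r$. A continuous symmetric kernel on a set $X$ is positive semidefinite if all its finite principal submatrices are. Moment hierarchy: for $r\ge1$, $\mathrm M_r(H)$ is the supremum of $\int_V\phi(\{x\})\,d\mu(x)$ over all $\phi\in C(\mathrm{Sub}_{2r}(V))$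 with $\phi(\emptyset)=1$, $\phi(S)=0$ for all non-independent $S\in\mathrm{Sub}_{2r}(V)$, and such that the kernel $(S,T)\mapsto\phi(S\cup T)$ on $\mathrm{Sub}_r(V)$ is positive semidefinite. Block moment hierarchy: for $r\ge2$, $\mathrm{blockM}_r(H)$ is the supremum of $\int_V\phi(\{x\})\,d\mu(x)$ over all $\phi\in C(\mathrm{Sub}_r(V))$ with $\phi(\emptyset)=1$, $\phi(S)=0$ for all non-independent $S\in\mathrm{Sub}_r(V)$, and such that for every $Q\in\mathcal I_{r-2}$ the kernel $(S,T)\mapsto\phi(Q\cup S\cup T)$ on $\mathrm{Sub}_1(V)$ is positive semidefinite. Pólya-type cones: $L^2_{\mathrm{sym}}(V,k)$ is the space of square-integrable functions on $V^k$ invariant under permutation of coordinates, with inner product $\langle F,G\rangle=\int FG\,d\mu^k$. For $K\in L^2_{\mathrm{sym}}(V,k)$ let $\mathcal T_rK(v_1,\dots,v_{k+r})=\frac1{(k+r)!}\sum_{\pi\in\mathfrak S_{k+r}}K(v_{\pi(1)},\dots,v_{\pi(k)})$. Put $C_r(V,k)=\{K\in L^2_{\mathrm{sym}}(V,k):\mathcal T_rK\ge0\text{ a.e.}\}$, let $C_r(V,k)^*$ be its dual cone in $L^2_{\mathrm{sym}}(V,k)$, and $C_r(V,k)^*_{\mathrm c}=C_r(V,k)^*\cap C(V^k)$. Theta programs: $A$ is slice positive if $\int_{V^{k-2}}\int_V\int_V A(x,y,v)G(v)f(x)f(y)\ge0$ for all $0\le G\in L^2(V^{k-2})$, $f\in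 L^2(V)$. For a convex cone $\mathcal C$ of continuous symmetric functions on $V^k$, both $\vartheta_{\mathrm{small}}(H,\mathcal C)$ and $\vartheta_{\mathrm{big}}(H,\mathcal C)$ are the supremum of $\int_{V^k}A\,d\mu^k$ over slice-positive $A\in\mathcal C$ with $A(v_1,\dots,v_k)=0$ for all $v_1\cdots v_k\in E$ and a normalization: for $\vartheta_{\mathrm{small}}$ it is $\int_VA(v,\dots,v)\,d\mu(v)=1$; for $\vartheta_{\mathrm{big}}$ it is $\mathrm{Tr}(\mathcal T^*_{k-2}A)=1$, where $(\mathcal T^*_{k-2}A)(x,y)=\int_{V^{k-2}}A(x,y,v)\,d\mu^{k-2}(v)$ and the kernel is required to be trace class with trace $1$. *)

(* Defs.v *)
From HB Require Import structures.
From mathcomp Require Import all_boot all_order all_algebra finmap perm.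
From mathcomp Require Import all_classical all_reals all_analysis.

Set Implicit Arguments.
Unset Strict Implicit.
Unset Printing Implicit Defensive.

Import Order.TTheory GRing.Theory Num.Theory.
Import numFieldNormedType.Exports.

Local Open Scope classical_set_scope.
Local Open Scope ring_scope.

HB.mixin Record isBorel (d : measure_display) T
    & Measurable d T & Topological T := {
  borelE : @measurable d T = <<s @open T >>
}.

#[short(type="borelType")]
HB.structure Definition Borel (d : measure_display) :=
  {T of Measurable d T & Topological T & isBorel d T}.

(* Every (pointed) topological space yields such a space. *)
Definition borel (T : ptopologicalType) : Type := g_sigma_algebraType (@open T).
HB.instance Definition _ (T : ptopologicalType) :=
  PointedTopological.copy (borel T) T.
HB.instance Definition _ (T : ptopologicalType) :=
  Measurable.copy (borel T) (g_sigma_algebraType (@open T)).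
HB.instance Definition _ (T : ptopologicalType) :=
  isBorel.Build _ (borel T) erefl.

HB.instance Definition _ (n : nat) (T : topologicalType) :=
  Topological.copy (n.-tuple T)
    (initial_topology (fun t : n.-tuple T => (tnth t : {ptws 'I_n -> T}))).

Section power_measure.
Context d (T : measurableType d) (R : realType).

Definition cons_pair (n : nat) (p : T * n.-tuple T) : n.+1.-tuple T :=
  [tuple of p.1 :: p.2].

Lemma measurable_cons_pair n : measurable_fun setT (@cons_pair n).
Proof. exact: measurable_cons. Qed.

Variable mu : {finite_measure set T -> \bar R}.

Section cons_measure.
Variables (n : nat) (nu : {finite_measure set (n.-tuple T) -> \bar R}).

Definition cons_measure : set (n.+1.-tuple T) -> \bar R :=
  pushforward (mu \x nu)%E (@cons_pair n).

HB.instance Definition _ := Measure.copy cons_measure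
  (measure_function_pushforward__canonical__measure_function_Measure
     (mu \x nu)%E (@measurable_cons_pair n)).

Lemma cons_measure_fin : fin_num_fun cons_measure.
Proof.
apply: lty_fin_num_fun.
rewrite -[ltLHS]/((mu \x nu)%E setT) -setXTT product_measure1E//.
by rewrite lte_mul_pinfty// ?ltey_eq ?fin_num_measure.
Qed.

HB.instance Definition _ :=
  Measure_isFinite.Build _ _ _ cons_measure cons_measure_fin.

End cons_measure.

Fixpoint mpow (n : nat) : {finite_measure set (n.-tuple T) -> \bar R} :=
  if n is n'.+1 then cons_measure (mpow n') else \d_([tuple] : 0.-tuple T).

End power_measure.

Definition permute_tuple (T : Type) (n : nat) (s : 'S_n) (t : n.-tuple T) :
    n.-tuple T :=
  [tuple tnth t (s i) | i < n].

Definition symmetric_fun (T U : Type) (n : nat) (F : n.-tuple T -> U) :=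
  forall (s : 'S_n) (t : n.-tuple T), F (permute_tuple s t) = F t.

Record uniform_hypergraph (V : choiceType) (k : nat) := UniformHypergraph {
  edges : set {fset V} ;
  card_edge : forall e, edges e -> #|` e| = k
}.

Section hypergraph.
Context (V : choiceType) (k : nat) (H : uniform_hypergraph V k).

Definition edge_tuples : set (k.-tuple V) :=
  [set v | edges H [fset x in (v : seq V)]%fset].

Definition independent (S : {fset V}) :=
  ~ exists2 e, edges H e & (e `<=` S)%fset.

End hypergraph.

Section subset_space.
Context (V : choiceType) (r : nat).

Definition SubSp : Type := {S : {fset V} | (#|` S| <= r)%N}.
HB.instance Definition _ := [isSub of SubSp for @sval _ _].
HB.instance Definition _ := [Choice of SubSp by <:].

Definition SubSp0 : SubSp := exist _ fset0 (leq0n r).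

(* Only ever applied to sets with at most [r] elements: on these it is the
   identity, and the default value [SubSp0] plays no role. *)
Definition to_SubSp (S : {fset V}) : SubSp := insubd SubSp0 S.

Definition tuple_to_SubSp (v : r.-tuple V) : SubSp :=
  to_SubSp [fset x in (v : seq V)]%fset.

End subset_space.

Section subset_space_topology.
Context (V : topologicalType) (r : nat).

(* The quotient topology of [(v_1, ..., v_r) |-> {v_1, ..., v_r}].  For [1 <= r]
   the image of this map is the set of nonempty sets, so that the empty set is
   both open and closed: it is the isolated point of the disjoint union. *)
Definition SubSp_open (U : set (SubSp V r)) := open (@tuple_to_SubSp V r @^-1` U).

Lemma SubSp_openT : SubSp_open setT.
Proof. by rewrite /SubSp_open preimage_setT; exact: openT. Qed.

Lemma SubSp_openI : setI_closed SubSp_open.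
Proof. by move=> A B ? ?; exact: openI. Qed.

Lemma SubSp_open_bigcup (I : Type) (f : I -> set (SubSp V r)) :
  (forall i, SubSp_open (f i)) -> SubSp_open (\bigcup_i f i).
Proof. by move=> fo; apply: bigcup_open => i _; exact: fo. Qed.

HB.instance Definition _ :=
  isOpenTopological.Build (SubSp V r) SubSp_openT SubSp_openI SubSp_open_bigcup.

End subset_space_topology.

Definition psd_kernel (R : realType) (X : Type) (K : X -> X -> R) :=
  forall (n : nat) (x : 'I_n -> X) (c : 'I_n -> R),
    0 <= \sum_(i < n) \sum_(j < n) c i * c j * K (x i) (x j).

Section moment_hierarchies.
Context d (V : borelType d) (R : realType).
Context (mu : {finite_measure set V -> \bar R}).
Context (k : nat) (H : uniform_hypergraph V k).

Definition moment_feasible (r : nat) (phi : SubSp V (2 * r) -> R) :=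
  [/\ continuous phi,
      phi (to_SubSp _ fset0) = 1,
      forall S : SubSp V (2 * r), ~ independent H (val S) -> phi S = 0
    & psd_kernel
        (fun S T : SubSp V r => phi (to_SubSp _ (val S `|` val T)%fset))].

Definition momentM (r : nat) : \bar R :=
  ereal_sup [set (\int[mu]_x phi (to_SubSp _ [fset x]%fset))%:E
            | phi in moment_feasible (r := r)].

Definition block_moment_feasible (r : nat) (phi : SubSp V r -> R) :=
  [/\ continuous phi,
      phi (to_SubSp _ fset0) = 1,
      forall S : SubSp V r, ~ independent H (val S) -> phi S = 0
    & forall Q : SubSp V (r - 2), independent H (val Q) ->
        psd_kernel
          (fun S T : SubSp V 1 =>
             phi (to_SubSp _ (val Q `|` val S `|` val T)%fset))].

Definition blockM (r : nat) : \bar R :=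
  ereal_sup [set (\int[mu]_x phi (to_SubSp _ [fset x]%fset))%:E
            | phi in block_moment_feasible (r := r)].

End moment_hierarchies.

Section trace_class.
Context d (T : measurableType d) (R : realType).
Context (mu : {finite_measure set T -> \bar R}).

Definition L2 : set (T -> R) := [set f | f \in Lfun mu 2%:E].

Definition dotL2 (f g : T -> R) : R := \int[mu]_x (f x * g x).

Definition orthonormal_basis (I : choiceType) (e : I -> T -> R) :=
  [/\ forall i, L2 (e i),
      forall i j, dotL2 (e i) (e j) = (i == j)%:R
    & forall f, L2 f -> (forall i, dotL2 f (e i) = 0) -> f = cst 0 %[ae mu]].

Definition kernel_op (K : T -> T -> R) (f : T -> R) : T -> R :=
  fun x => \int[mu]_y (K x y * f y).

(* [P] represents [|A| = sqrt (A^* A)]: a positive self-adjoint operator on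
   [L^2(mu)] with [P^2 = A^* A].  Operators act on representatives; an operator
   that is symmetric on all of [L^2] automatically respects almost everywhere
   equality, is linear up to null sets, and is bounded (Hellinger-Toeplitz). *)
Definition operator_modulus (A P : (T -> R) -> T -> R) :=
  [/\ forall f, L2 f -> L2 (P f),
      forall f g, L2 f -> L2 g -> dotL2 (P f) g = dotL2 f (P g),
      forall f, L2 f -> 0 <= dotL2 (P f) f
    & forall f g, L2 f -> L2 g -> dotL2 (P f) (P g) = dotL2 (A f) (A g)].

Definition trace_class (A : (T -> R) -> T -> R) :=
  (forall f, L2 f -> L2 (A f)) /\
  exists2 P, operator_modulus A P &
    forall (I : choiceType) (e : I -> T -> R), orthonormal_basis e ->
      (\esum_(i in [set: I]) (dotL2 (P (e i)) (e i))%:E < +oo)%E.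

(* The sum over the basis is unordered and may have terms of both signs, so it
   is written as the sum of positive parts minus that of negative parts. *)
Definition trace_eq (A : (T -> R) -> T -> R) (t : R) :=
  forall (I : choiceType) (e : I -> T -> R), orthonormal_basis e ->
    let a := fun i => (dotL2 (A (e i)) (e i))%:E in
    (esum [set: I] a^\+ - esum [set: I] a^\-)%E = t%:E.

End trace_class.

Section theta.
Context d (V : borelType d) (R : realType).
Context (mu : {finite_measure set V -> \bar R}).
Context (k : nat).

Definition L2sym : set (k.-tuple V -> R) :=
  [set F | L2 (mpow mu k) F /\ symmetric_fun F].

Definition symmetrize (r : nat) (K : k.-tuple V -> R)
    (v : (k + r).-tuple V) : R :=
  ((k + r)`!%:R)^-1 *
  \sum_(s : 'S_(k + r)) K [tuple tnth v (s (lshift r i)) | i < k].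

Definition polya_cone (r : nat) : set (k.-tuple V -> R) :=
  [set K | L2sym K /\
           {ae mpow mu (k + r), forall v, 0 <= symmetrize (r := r) K v}].

Definition dual_cone (C : set (k.-tuple V -> R)) : set (k.-tuple V -> R) :=
  [set F | L2sym F /\ forall K, C K -> 0 <= dotL2 (mpow mu k) F K].

Definition polya_dual_c (r : nat) : set (k.-tuple V -> R) :=
  dual_cone (polya_cone r) `&` [set A | continuous A].

(* [(x, y, v)] as an element of [V^k]; meant for [2 <= k], when the list has
   length [k] and the default value of [nth] is irrelevant. *)
Definition cons2_tuple (x y : V) (v : k.-2.-tuple V) : k.-tuple V :=
  [tuple nth x [:: x, y & v] i | i < k].

Definition slice_positive (A : k.-tuple V -> R) :=
  forall (G : k.-2.-tuple V -> R) (f : V -> R),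
    L2 (mpow mu k.-2) G -> (forall v, 0 <= G v) -> L2 mu f ->
    0 <= \int[mpow mu k.-2]_v \int[mu]_x \int[mu]_y
           (A (cons2_tuple x y v) * G v * f x * f y).

Definition slice_average (A : k.-tuple V -> R) (x y : V) : R :=
  \int[mpow mu k.-2]_v A (cons2_tuple x y v).

Section programs.
Context (H : uniform_hypergraph V k) (C : set (k.-tuple V -> R)).

Definition theta_small_feasible (A : k.-tuple V -> R) :=
  [/\ C A, slice_positive A,
      forall v, edge_tuples H v -> A v = 0
    & \int[mu]_x A (nseq_tuple k x) = 1].

Definition theta_big_feasible (A : k.-tuple V -> R) :=
  [/\ C A, slice_positive A,
      forall v, edge_tuples H v -> A v = 0
    & trace_class mu (kernel_op mu (slice_average A)) /\
      trace_eq mu (kernel_op mu (slice_average A)) 1].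

(* The objective is nonnegative on slice-positive functions (take [G = 1] and
   [f = 1]), and the suprema are taken in [[0, +oo]]: an infeasible program has
   value [0], not [-oo].  Infeasible programs do occur, for instance for
   [k = 2] and the complete graph on [[0, 1]], where continuity forces [A = 0]. *)
Definition theta_small : \bar R :=
  maxe 0%E (ereal_sup [set (\int[mpow mu k]_v A v)%:E
                      | A in theta_small_feasible]).

Definition theta_big : \bar R :=
  maxe 0%E (ereal_sup [set (\int[mpow mu k]_v A v)%:E
                      | A in theta_big_feasible]).

End programs.
End theta.

Arguments L2sym {d V R} mu k _.
Arguments polya_cone {d V R} mu k r _.
Arguments polya_dual_c {d V R} mu k r _.

(* Main.v *)
Require Import Defs.
From HB Require Import structures.
From mathcomp Require Import all_boot all_order all_algebra finmap perm.
From mathcomp Require Import all_classical all_reals all_analysis.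
From mathcomp Require Import measurable_realfun.
From mathcomp Require Import ring lra.
Import Order.TTheory GRing.Theory Num.Theory.
Import numFieldNormedType.Exports.
Local Open Scope classical_set_scope.
Local Open Scope ring_scope.

(** The bound of the moment hierarchy by the block hierarchy is a restriction
    of test functions ([momentM_le_blockM]).  Both upper bounds come from one explicit feasible point of the theta
    programs, built from a feasible function phi of the block hierarchy.

    View phi as a function P of lists that depends only on their sets of
    entries.  If mu is the counting measure and X a random independent set,
    the model is P s = Prob (s is contained in X), and
      m j = integral of P (v_1, ..., v_j)
    is the j-th moment of the size of X.  Only a bounded amount of
    positivity is available: for each short list q the matrices
    P (q, a, b), with a and b either empty or a point, are positive
    semidefinite.  This structure is [pseudo_moments], and a feasible phi
    gives one by [block_feasible_pseudo_moments].

    Testing the positivity with the constant function on the points and a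
    multiple of the empty set, and integrating over q, gives
      m (j+2) - 2 (m 1) (m (j+1)) + (m 1)^2 (m j) >= 0,
    so that the differences m (j+1) - (m 1) (m j), which start from 0, stay
    nonnegative.  Hence m (j+1) >= (m 1) (m j) ([moment_step]).  Here m 1 is
    the objective value of phi, and only the case m 1 > 0 matters, as the
    values of the theta programs are nonnegative.

    The feasible point is a multiple of
      A (v) = integral over w in V^r of P (v, w)      ([dual_fun]).
    It is the adjoint of the symmetrization operator T_r applied to the
    nonnegative function P on V^(k+r).  By Fubini and the invariance of the
    product measure under permutations, <A, F> = integral of P * (T_r F) for
    every F, and this is nonnegative on the Polya-type cone
    ([dual_fun_polya_ge0]).  Each slice of A is a continuous positive
    semidefinite kernel, and A vanishes on edges as P does.  The integral of
    A is m (k+r) and that of its diagonal is m (r+1), and the moment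
    inequality turns m (k+r) / m (r+1) >= (m 1)^(k-1) into the first bound.

    For the second bound the normalization is the trace of the slice average
    of A.  By Mercer's formula ([mercer_trace]) this is the integral of its
    diagonal, m (k+r-1), and m (k+r) / m (k+r-1) >= m 1.  The formula has to
    hold for every orthonormal basis of L2(mu), which may be inseparable.
    The proof writes a continuous positive semidefinite kernel as a finite
    sum of g(x) g(y) plus a positive semidefinite kernel with uniformly small
    diagonal ([psd_finite_rank]), by finitely many pivoting steps at the
    points of a finite net.  The finite rank part is handled by Parseval's
    identity, which uses the completeness of L2 ([L2_fast_cauchy_cvg]), and
    the rest has small trace.  The same decomposition shows that the kernel
    has a nonnegative quadratic form on all of L2 ([quad_form_ge0]).

    Fubini's theorem concerns the product sigma-algebra of V^n, which may be
    smaller than the Borel sigma-algebra of the product topology.  Continuous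
    functions on V^n are nevertheless measurable for it, since V is compact
    ([continuous_tuple_measurable]). *)

Set Implicit Arguments.
Unset Strict Implicit.
Unset Printing Implicit Defensive.

(** * Compactness and topology of finite powers *)

Section compactness.
Context (X : topologicalType) (cX : compact [set: X]).

(** Compactness in the form used throughout: a finite set of centres whose
    neighbourhoods cover the space, each centre keeping the neighbourhood
    chosen for it. *)
Lemma compact_finite_net (U : X -> set X) :
  (forall x, nbhs x (U x)) -> exists s : seq X, forall x, exists2 y, y \in s & U y x.
Proof.
move=> nU.
(* near coverings are tested along the filter of all large finite lists *)
pose F : set_system (seq X) := [set P | exists s0 : seq X, forall s : seq X, {subset s0 <= s} -> P s].
have FF : Filter F.
  split.
  - by exists [::].
  - move=> P Q [s sP] [t tQ]; exists (s ++ t) => u su; split.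
      by apply: sP => x xs; apply: su; rewrite mem_cat xs.
    by apply: tQ => x xs; apply: su; rewrite mem_cat xs orbT.
  - by move=> P Q PQ [s sP]; exists s => t /sP /PQ.
have /compact_near_coveringP /(_ _ F (fun s x => exists2 y, y \in s & U y x) FF) := cX.
case=> [x _|s hs]; last first.
  by exists s => x; apply: (hs s _ x).
exists (U x, [set s : seq X | x \in s]) => /=.
  split; first exact: nU.
  by exists [:: x] => s; apply; rewrite inE.
by move=> [y s] [/= Uy xs]; exists x.
Qed.

Lemma compact_continuous_bounded (R : realType) (f : X -> R) :
  continuous f -> exists M, forall x, `|f x| <= M.
Proof.
move=> cf.
have [x|s hs] := @compact_finite_net (fun x => [set y | `|f x - f y| < 1]).
  by have /cvgrPdist_lt := cf x; apply; exact: ltr01.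
exists (\sum_(y <- s) `|f y| + 1) => x.
have [y ys /= fxy] := hs x.
have -> : f x = f y - (f y - f x) by rewrite opprB addrC subrK.
apply: (le_trans (ler_normB _ _)); apply: lerD; last exact: ltW.
by rewrite (big_rem y)//= lerDl sumr_ge0.
Qed.

End compactness.

Section tube.
Context (X Y : topologicalType) (R : realType).

(** A continuous function of two variables is continuous in the first one
    uniformly in a compact second one; this makes integrals over the second
    variable continuous. *)
Lemma tube_uniform (cY : compact [set: Y]) (B : X * Y -> R) :
  continuous B -> forall (x0 : X) (e : R), 0 < e ->
  \forall x \near x0, forall y, `|B (x0, y) - B (x, y)| < e.
Proof.
move=> cB x0 e e0.
suff : \forall x \near x0, [set: Y] `<=` (fun y => `|B (x0, y) - B (x, y)| < e).
  by apply: filterS => x h y; exact: h.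
apply: (proj1 (compact_near_coveringP _) cY) => y _.
have e2 : 0 < e / 2 by rewrite divr_gt0.
have /cvgrPdist_lt/(_ _ e2) := cB (x0, y).
move=> [[P Q] /= [nP nQ] PQ].
exists (Q, P) => //= -[y' x'] [/= Qy Px].
have := PQ (x', y') (conj Px Qy) => /= h1.
have := PQ (x0, y') (conj (nbhs_singleton nP) Qy) => /= h2.
rewrite distrC in h2.
rewrite [e]splitr.
apply: le_lt_trans (ltrD h2 h1).
by rewrite -[X in `|X - _|](subrK (B (x0, y))) -addrA ler_normD.
Qed.

End tube.

Lemma continuous_pair (X Y Z : topologicalType) (f : X -> Y) (g : X -> Z) :
  continuous f -> continuous g -> continuous (fun x => (f x, g x)).
Proof. by move=> cf cg x; apply: cvg_pair; [exact: cf|exact: cg]. Qed.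

Section boxes.

Definition box (T : Type) n (A : 'I_n -> set T) : set (n.-tuple T) :=
  [set u | forall i, A i (tnth u i)].

Lemma box_bigsetI (T : Type) n (A : 'I_n -> set T) :
  box A = \big[setI/setT]_(i < n) ((fun u : n.-tuple T => tnth u i) @^-1` (A i)).
Proof.
apply/seteqP; split=> u.
  by move=> h; rewrite -bigcap_seq => i /=.
by rewrite -bigcap_seq => h i; apply: h => /=; rewrite mem_index_enum.
Qed.

Lemma measurable_box d (T : measurableType d) n (A : 'I_n -> set T) :
  (forall i, measurable (A i)) -> measurable (box A).
Proof.
move=> mA; rewrite box_bigsetI; apply: bigsetI_measurable => i _.
by rewrite -[_ @^-1` _]setTI; exact: measurable_tnth.
Qed.

End boxes.

Section tuple_topology.
Context (T : topologicalType).

Lemma tnth_continuous n (i : 'I_n) : continuous (fun t : n.-tuple T => tnth t i).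
Proof.
move=> t.
apply: (@continuous_comp _ _ _ (fun t : n.-tuple T => (tnth t : {ptws 'I_n -> T}))
  (fun g => g i)).
  exact: initial_continuous.
exact: (@proj_continuous _ (fun=> T)).
Qed.

(** The topology of [n.-tuple T] is that of coordinatewise convergence. *)
Lemma cvg_tuple n (F : set_system (n.-tuple T)) (t : n.-tuple T) : Filter F ->
  (forall i, (fun u => tnth u i) @ F --> tnth t i) -> F --> t.
Proof.
move=> FF cF U [?/= [[W oW <-]]] /= Wt /filterS; apply.
have : (fun u : n.-tuple T => (tnth u : {ptws 'I_n -> T})) @ F --> (tnth t : {ptws 'I_n -> T}).
  apply/cvg_sup => i A [B [[C oC <-] /= Ct] sB].
  rewrite nbhs_filterE; apply: filterS sB _.
  by apply: (cF i); exact: open_nbhs_nbhs.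
by apply; exact: open_nbhs_nbhs.
Qed.

Lemma continuous_tuple (X : topologicalType) n (f : X -> n.-tuple T) :
  (forall i, continuous (fun x => tnth (f x) i)) -> continuous f.
Proof. by move=> cf x; apply: cvg_tuple => i; exact: cf. Qed.

Lemma nbhs_tuple_box n (t : n.-tuple T) (U : set (n.-tuple T)) : nbhs t U ->
  exists2 A : 'I_n -> set T, (forall i, open (A i) /\ A i (tnth t i)) &
    box A `<=` U.
Proof.
pose D : set ('I_n -> set T) := [set A | forall i, open (A i) /\ A i (tnth t i)].
pose F := filter_from D (@box T n).
have FF : Filter F.
  apply: filter_from_filter.
    by exists (fun=> setT) => i; split=> //; exact: openT.
  move=> A B DA DB; exists (fun i => A i `&` B i).
    move=> i; have [oA At] := DA i; have [oB Bt] := DB i.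
    by split=> //; exact: openI.
  by move=> u h; split=> i; have [] := h i.
have : F --> t.
  apply: cvg_tuple => i W; rewrite nbhsE => -[B [oB Bt] BW].
  exists (fun j => if j == i then B else setT).
    by move=> j; case: eqP => [->//|_]; split=> //; exact: openT.
  by move=> u /(_ i); rewrite eqxx => /BW.
by move=> /[apply] -[A DA AU]; exists A.
Qed.

Lemma box_nbhs n (A : 'I_n -> set T) (t : n.-tuple T) :
  (forall i, nbhs (tnth t i) (A i)) -> nbhs t (box A).
Proof.
move=> nA; rewrite box_bigsetI; apply: (big_ind (fun W => nbhs t W)).
- exact: filterT.
- by move=> ? ?; exact: filterI.
- by move=> i _; apply: (tnth_continuous (i := i) (x := t)); exact: nA.
Qed.

Lemma cons_pair_continuous n : continuous (fun p : T * n.-tuple T => [tuple of p.1 :: p.2]).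
Proof.
apply: continuous_tuple => i.
case: (unliftP ord0 i) => [j ->|->].
  under eq_fun => x do rewrite tnthS.
  by move=> x; apply: (@continuous_comp _ _ _ snd (fun t : _.-tuple T => tnth t j)); [exact: cvg_snd|exact: tnth_continuous].
by move=> x; under eq_fun => y do rewrite tnth0; exact: cvg_fst.
Qed.

Lemma tuple_compact n : compact [set: T] -> compact [set: n.-tuple T].
Proof.
move=> cT; elim: n => [|n IH].
  have -> : [set: 0.-tuple T] = [set [tuple]].
    by apply/seteqP; split=> // t _ /=; exact: tuple0.
  exact: compact_set1.
have -> : [set: n.+1.-tuple T] =
    (fun p : T * n.-tuple T => [tuple of p.1 :: p.2]) @` (setT `*` setT).
  apply/seteqP; split=> // t _; exists (thead t, [tuple of behead t]) => //=.
  by rewrite -tuple_eta.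
apply: continuous_compact; last exact: compact_setX.
by apply: continuous_subspaceT; exact: cons_pair_continuous.
Qed.

Lemma reindex_continuous n m (f : 'I_m -> 'I_n) :
  continuous (fun t : n.-tuple T => [tuple tnth t (f i) | i < m]).
Proof.
apply: continuous_tuple => i; under eq_fun => x do rewrite tnth_mktuple.
exact: tnth_continuous.
Qed.

Lemma cat_continuous n m :
  continuous (fun p : n.-tuple T * m.-tuple T => [tuple of p.1 ++ p.2]).
Proof.
apply: continuous_tuple => i.
case: (split_ordP i) => j ->.
  under eq_fun => x do rewrite tnth_lshift.
  by move=> x; apply: (@continuous_comp _ _ _ fst (fun t : _.-tuple T => tnth t j)); [exact: cvg_fst|exact: tnth_continuous].
under eq_fun => x do rewrite tnth_rshift.
by move=> x; apply: (@continuous_comp _ _ _ snd (fun t : _.-tuple T => tnth t j)); [exact: cvg_snd|exact: tnth_continuous].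
Qed.

End tuple_topology.

Section tuple_maps.
Context (T X : topologicalType).

Lemma tuple_cons_continuous n (f : X -> T) (g : X -> n.-tuple T) :
  continuous f -> continuous g -> continuous (fun x => [tuple of f x :: g x]).
Proof.
move=> cf cg x.
apply: (@continuous_comp _ _ _ (fun x => (f x, g x))
  (fun p : T * n.-tuple T => [tuple of p.1 :: p.2])).
  exact: continuous_pair.
exact: cons_pair_continuous.
Qed.

Lemma tuple_cat_continuous n m (f : X -> n.-tuple T) (g : X -> m.-tuple T) :
  continuous f -> continuous g -> continuous (fun x => [tuple of f x ++ g x]).
Proof.
move=> cf cg x.
apply: (@continuous_comp _ _ _ (fun x => (f x, g x))
  (fun p : n.-tuple T * m.-tuple T => [tuple of p.1 ++ p.2])).
  exact: continuous_pair.
exact: cat_continuous.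
Qed.

End tuple_maps.

(** * Measurability of continuous functions of several variables *)

Section continuous_measurable.
Context d (V : borelType d) (R : realType) (cV : compact [set: V]).

Lemma open_borel (A : set V) : open A -> measurable A.
Proof. by move=> oA; rewrite borelE; exact: sub_sigma_algebra. Qed.

(** Between the levels a and a + 1/(m+1) of F a compactness argument inserts a
    finite union of open boxes, which is measurable for the product
    sigma-algebra; so the open set F > a is a countable union of such finite
    unions. *)
Lemma continuous_tuple_measurable n (F : n.-tuple V -> R) :
  continuous F -> measurable_fun setT F.
Proof.
move=> cF; apply: (measurability _ (RGenOInfty.measurableE R)) => _ [_ [a ->] <-].
rewrite setTI.
have step (m : nat) : exists W : set (n.-tuple V), [/\ measurable W,
    W `<=` F @^-1` `]a, +oo[ & forall t, a + m.+1%:R^-1 <= F t -> W t].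
  have nbox (t : n.-tuple V) : exists A : 'I_n -> set V, [/\ forall i, open (A i),
      forall i, A i (tnth t i) &
      a < F t -> forall u, box A u -> a < F u].
    have [at_|at_] := boolP (a < F t); last first.
      by exists (fun=> setT); split=> // i; exact: openT.
    have : nbhs t [set u | a < F u].
      exact: (@cvgr_gt _ _ _ _ _ _ (cF t)).
    move=> /nbhs_tuple_box [A oA AU]; exists A; split=> [i|i|_ u /AU//]; by have [] := oA i.
  have [A hA] := choice nbox.
  pose U t := if a < F t then box (A t)
              else [set u | F u < a + m.+1%:R^-1].
  have nU t : nbhs t (U t).
    rewrite /U; case: ifPn => at_.
      have [oA At _] := hA t.
      by apply: box_nbhs => i; exact: open_nbhs_nbhs.
    have h : F t < a + m.+1%:R^-1.
      by rewrite -leNgt in at_; apply: (le_lt_trans at_); rewrite ltrDl invr_gt0.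
    exact: (@cvgr_lt _ _ _ _ _ _ (cF t)).
  have [s hs] := compact_finite_net (@tuple_compact _ n cV) nU.
  exists (\bigcup_(t in [set t | t \in [seq t <- s | a < F t]]) box (A t)).
  split.
  - rewrite bigcup_seq; apply: bigsetU_measurable => t _.
    by apply: measurable_box => i; apply: open_borel; have [] := hA t.
  - move=> u [t /=]; rewrite mem_filter => /andP[at_ _] Au.
    by rewrite in_itv/= andbT; have [_ _] := hA t; apply.
  - move=> u Fu; have [t ts] := hs u; rewrite /U; case: ifPn => at_.
      by exists t => //=; rewrite mem_filter at_.
    by move=> /=; rewrite ltNge Fu.
have [W hW] := choice step.
have -> : F @^-1` `]a, +oo[ = \bigcup_m W m.
  apply/seteqP; split=> u; last by move=> [m _]; have [_ + _] := hW m; exact.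
  rewrite /= in_itv/= andbT -subr_gt0 => h.
  have [m hm] : exists m : nat, m.+1%:R^-1 <= F u - a.
    have [m mh] := ltr_add_invr h; exists m; apply: ltW.
    by rewrite add0r in mh.
  exists m => //; have [_ _] := hW m; apply.
  by rewrite addrC -lerBrDr.
by apply: bigcupT_measurable => m; have [] := hW m.
Qed.

End continuous_measurable.

(** * Real-valued integrals and Fubini's theorem *)

Notation integ mu f := (mu.-integrable [set: _] (EFin \o f)).

Section integ_lemmas.
Context d (T : measurableType d) (R : realType) (mu : {finite_measure set T -> \bar R}).

Lemma integ_bounded (f : T -> R) M : measurable_fun setT f ->
  (forall x, `|f x| <= M) -> integ mu f.
Proof.
move=> mf fM; apply: measurable_bounded_integrable => //.
  by rewrite ltey_eq fin_num_measure.
by exists M; split=> [|N MN x _ /=]; [exact: num_real|exact: le_trans (fM x) (ltW MN)].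
Qed.

Lemma integ_bounded_mul (f h : T -> R) M : measurable_fun setT h ->
  (forall x, `|h x| <= M) -> integ mu f -> integ mu (fun x => h x * f x).
Proof.
move=> mh hM intf; apply: (@integrableMr _ _ _ mu _ measurableT h (EFin \o f)) => //.
by exists M; split=> [|N MN x _ /=]; [exact: num_real|exact: le_trans (hM x) (ltW MN)].
Qed.

Lemma Rintegral_norm_le (f : T -> R) M : integ mu f -> (forall x, `|f x| <= M) ->
  `|\int[mu]_x f x| <= M * fine (mu setT).
Proof.
move=> intf fM; apply: (le_trans (le_normr_Rintegral _ intf)) => //.
rewrite -Rintegral_cst//; apply: le_Rintegral => //.
- exact: (@integrable_norm _ _ _ mu setT f).
- exact: finite_measure_integrable_cst.
Qed.

Lemma Rintegral_sum (I : Type) (s : seq I) (f : I -> T -> R) :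
  (forall i, integ mu (f i)) ->
  \int[mu]_x (\sum_(i <- s) f i x) = \sum_(i <- s) \int[mu]_x f i x.
Proof.
move=> intf; elim: s => [|i s IH].
  by under eq_Rintegral => x _ do rewrite big_nil; rewrite Rintegral_cst// mul0r big_nil.
under eq_Rintegral => x _ do rewrite big_cons.
rewrite RintegralD//; first by rewrite IH big_cons.
have -> : EFin \o (fun x => \sum_(i <- s) f i x) =
    (fun x => \sum_(i <- s) (f i x)%:E)%E by apply/funext => x /=; rewrite sumEFin.
exact: (@integrable_sum _ _ _ mu _ measurableT _ s xpredT (fun i => EFin \o f i)).
Qed.

Lemma integ_sum (I : Type) (s : seq I) (f : I -> T -> R) :
  (forall i, integ mu (f i)) -> integ mu (fun x => \sum_(i <- s) f i x).
Proof.
move=> intf.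
have -> : EFin \o (fun x => \sum_(i <- s) f i x) =
    (fun x => \sum_(i <- s) (f i x)%:E)%E by apply/funext => x /=; rewrite sumEFin.
exact: (@integrable_sum _ _ _ mu _ measurableT _ s xpredT (fun i => EFin \o f i)).
Qed.

Lemma integD (f g : T -> R) : integ mu f -> integ mu g -> integ mu (fun x => f x + g x).
Proof. exact: integrableD. Qed.

Lemma integB (f g : T -> R) : integ mu f -> integ mu g -> integ mu (fun x => f x - g x).
Proof. exact: integrableB. Qed.

Lemma integZ (c : R) (f : T -> R) : integ mu f -> integ mu (fun x => c * f x).
Proof. exact: integrableZl. Qed.

Lemma integZr (c : R) (f : T -> R) : integ mu f -> integ mu (fun x => f x * c).
Proof. exact: integrableZr. Qed.

Lemma integ_measurable (f : T -> R) : integ mu f -> measurable_fun setT f.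
Proof. by move=> /measurable_int/measurable_EFinP. Qed.

End integ_lemmas.

Section pushforward_integral.
Context d1 d2 (X : measurableType d1) (Y : measurableType d2) (R : realType).
Context (phi : X -> Y) (m1 : {measure set X -> \bar R}) (m2 : {measure set Y -> \bar R}).
Context (mphi : measurable_fun setT phi)
  (m12 : forall A, measurable A -> m1 (phi @^-1` A) = m2 A).

Lemma integ_pushforward (f : Y -> R) : measurable_fun setT f ->
  integ m1 (f \o phi) -> integ m2 f.
Proof.
move=> mf intf; have mfE : measurable_fun setT (EFin \o f) by exact/measurable_EFinP.
apply/integrableP; split=> //.
have /integrableP[_] := integrable_pushforward mphi mfE intf measurableT.
have -> : (\int[m2]_x `|(EFin \o f) x| = \int[pushforward m1 phi]_x `|(EFin \o f) x|)%E.
  by apply: eq_measure_integral => A mA _; rewrite -m12.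
by [].
Qed.

Lemma integ_pullback (f : Y -> R) : integ m2 f -> integ m1 (f \o phi).
Proof.
move=> intf; have mf := measurable_int _ intf.
apply/integrableP; split; first exact: measurableT_comp mf mphi.
have /integrableP[_] := intf.
rewrite (@eq_measure_integral _ _ _ _ (pushforward m1 phi)); last first.
  by move=> A mA _; rewrite -m12.
by rewrite ge0_integral_pushforward//; exact: measurableT_comp.
Qed.

Lemma Rintegral_pushforward (f : Y -> R) : integ m2 f ->
  \int[m2]_y f y = \int[m1]_x f (phi x).
Proof.
move=> intf; rewrite /Rintegral; congr fine.
rewrite (@eq_measure_integral _ _ _ _ (pushforward m1 phi)); last first.
  by move=> A mA _; rewrite -m12.
apply: integral_pushforward => //; first exact: measurable_int intf.
exact: integ_pullback.
Qed.

End pushforward_integral.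

Section fubini_real.
Context d1 d2 (T1 : measurableType d1) (T2 : measurableType d2) (R : realType).
Context (m1 : {finite_measure set T1 -> \bar R}) (m2 : {finite_measure set T2 -> \bar R}).

(** All slices are required to be integrable, and not only almost all of them:
    [Rintegral] turns an infinite inner integral into 0, so this makes the
    iterated real integral agree with the extended one at every point. *)
Lemma Rintegral_prod1 (f : T1 * T2 -> R) : integ (m1 \x m2)%E f ->
  (forall x, integ m2 (fun y => f (x, y))) ->
  \int[(m1 \x m2)%E]_p f p = \int[m1]_x \int[m2]_y f (x, y).
Proof.
move=> intf intfx; rewrite /Rintegral -integral12_prod_meas1//; congr fine.
apply: eq_integral => x _; rewrite /fubini_F /= fineK//.
by apply: integrable_fin_num => //; exact: intfx.
Qed.

Lemma Rintegral_prod2 (f : T1 * T2 -> R) : integ (m1 \x m2)%E f ->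
  (forall y, integ m1 (fun x => f (x, y))) ->
  \int[(m1 \x m2)%E]_p f p = \int[m2]_y \int[m1]_x f (x, y).
Proof.
move=> intf intfy; rewrite /Rintegral -integral21_prod_meas1//; congr fine.
apply: eq_integral => x _; rewrite /fubini_G /= fineK//.
by apply: integrable_fin_num => //; exact: intfy.
Qed.

Lemma integ_prod1 (f : T1 * T2 -> R) : integ (m1 \x m2)%E f ->
  (forall x, integ m2 (fun y => f (x, y))) ->
  integ m1 (fun x => \int[m2]_y f (x, y)).
Proof.
move=> intf intfx; have := integrable_fubini_F intf.
apply: eq_integrable => // x _; rewrite /fubini_F /= fineK//.
by apply: integrable_fin_num => //; exact: intfx.
Qed.

(** The form in which Fubini's theorem is applied: the kernel is bounded and
    the variables are otherwise separated. *)
Lemma integ_prod_mul (f : T1 -> R) (g : T2 -> R) (h : T1 * T2 -> R) M :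
  integ m1 f -> integ m2 g -> measurable_fun setT h -> (forall p, `|h p| <= M) ->
  integ (m1 \x m2)%E (fun p => h p * (f p.1 * g p.2)).
Proof.
move=> intf intg mh hM.
have mf := integ_measurable intf; have mg := integ_measurable intg.
have mfg : measurable_fun setT (fun p : T1 * T2 => f p.1 * g p.2).
  by apply: measurable_funM; apply: measurableT_comp.
have M0 : 0 <= M by apply: (le_trans (normr_ge0 (h point))).
apply: (@le_integrable _ _ _ _ _ measurableT _ (EFin \o (fun p : T1 * T2 => M * (f p.1 * g p.2)))).
- by apply/measurable_EFinP; exact: measurable_funM.
- move=> p _ /=; rewrite lee_fin normrM [leRHS]normrM; apply: ler_wpM2r => //.
  by rewrite (ger0_norm M0).
apply: (@integrableZl _ _ _ (m1 \x m2)%E setT measurableT M (EFin \o (fun p => f p.1 * g p.2))).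
apply/integrable12ltyP; first exact/measurable_EFinP.
have -> : (\int[m1]_x \int[m2]_y `|(EFin \o (fun p => (f p.1 * g p.2)%R)) (x, y)| =
   \int[m1]_x (`|f x|%:E * \int[m2]_y `|(g y)%:E|))%E.
  apply: eq_integral => x _ /=.
  under eq_integral => y _ do rewrite normrM EFinM.
  rewrite ge0_integralZl//; apply/measurable_EFinP; exact: measurableT_comp.
have /integrableP[_ fy] := intf; have /integrableP[mgE gy] := intg.
rewrite ge0_integralZr//; last 2 first.
- by apply/measurable_EFinP; exact: measurableT_comp.
- exact: integral_ge0.
rewrite lte_mul_pinfty//.
- exact: integral_ge0.
- by rewrite ge0_fin_numE//; exact: integral_ge0.
Qed.

End fubini_real.

(** * Invariance of the powers of a finite measure *)

Section tuple_measures.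
Context d (T : measurableType d) (R : realType).

(** The measurable boxes are stable under intersection and generate the
    sigma-algebra of tuples. *)
Lemma tuple_measure_eq n (m1 m2 : {measure set (n.-tuple T) -> \bar R}) :
  (m1 setT < +oo)%E ->
  (forall A : 'I_n -> set T, (forall i, measurable (A i)) -> m1 (box A) = m2 (box A)) ->
  forall A, measurable A -> m1 A = m2 A.
Proof.
move=> m1oo m12.
pose G : set (set (n.-tuple T)) := [set B | exists2 A : 'I_n -> set T, (forall i, measurable (A i)) & B = box A].
have GT : G setT.
  by exists (fun=> setT) => //; apply/seteqP; split.
apply: (measure_unique G (fun=> setT)) => //.
- apply/seteqP; split; last first.
    apply: smallest_sub; first exact: sigma_algebra_measurable.
    by move=> _ [A mA ->]; exact: measurable_box.
  apply: smallest_sub; first exact: smallest_sigma_algebra.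
  move=> B; rewrite -bigcup_seq => -[i /= _ [C mC <-]].
  apply: sub_sigma_algebra; exists (fun j => if j == i then C else setT).
    by move=> j; case: eqP.
  apply/seteqP; split=> u /=.
    by move=> [_ Cu] j; case: eqP => [->|].
  by move=> /(_ i); rewrite eqxx.
- move=> _ _ [A mA ->] [B mB ->]; exists (fun i => A i `&` B i).
    by move=> i; exact: measurableI.
  apply/seteqP; split=> u /=.
    by move=> [Au Bu] i; split.
  by move=> h; split=> i; have [] := h i.
- by rewrite bigcup_const//; exists 0%N.
- by move=> _ [A mA ->]; exact: m12.
Qed.

Context (mu : {finite_measure set T -> \bar R}).

Lemma mpow_box n (A : 'I_n -> set T) : (forall i, measurable (A i)) ->
  mpow mu n (box A) = (\prod_(i < n) fine (mu (A i)))%:E.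
Proof.
elim: n A => [|n IH] A mA.
  by rewrite big_ord0 /= diracE mem_set// => -[].
rewrite big_ord_recl EFinM /= /cons_measure /pushforward.
have -> : @cons_pair _ T n @^-1` box A = A ord0 `*` @box T n (fun i : 'I_n => A (lift ord0 i)).
  apply/seteqP; split=> -[x u] /=.
    move=> h; split; first by have := h ord0; rewrite tnth0.
    by move=> i; have := h (lift ord0 i); rewrite tnthS.
  move=> [Ax Au] i; case: (unliftP ord0 i) => [j ->|->]; first by rewrite tnthS; exact: Au.
  by rewrite tnth0.
rewrite product_measure1E//; last exact: measurable_box.
by rewrite [X in (_ * X)%E](IH (fun i : 'I_n => A (lift ord0 i)))//= fineK// fin_num_measure.
Qed.

Lemma mpow_fin n : (mpow mu n setT < +oo)%E.
Proof. by rewrite ltey_eq fin_num_measure. Qed.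

Lemma measurable_reindex n m (f : 'I_m -> 'I_n) :
  measurable_fun setT (fun t : n.-tuple T => [tuple tnth t (f i) | i < m]).
Proof.
apply/measurable_fun_tnthP => i.
rewrite (_ : _ \o _ = (fun t => tnth t (f i))); first exact: measurable_tnth.
by apply/funext => t /=; rewrite tnth_mktuple.
Qed.

(** A permutation of the coordinates permutes the sides of a box, and the
    product of their measures does not change. *)
Lemma mpow_permute n (s : 'S_n) A : measurable A ->
  mpow mu n (permute_tuple s @^-1` A) = mpow mu n A.
Proof.
move=> mA.
have ms : measurable_fun setT (@permute_tuple T n s) by exact: measurable_reindex.
pose m1 := measure_function_pushforward__canonical__measure_function_Measure
     (mpow mu n) ms.
rewrite -[LHS]/(m1 A); apply: tuple_measure_eq => //.
- exact: mpow_fin.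
- move=> {mA} {}A mA; rewrite [RHS](mpow_box mA) /m1 /= /pushforward.
  have -> : permute_tuple s @^-1` box A = box (fun i => A ((s^-1)%g i)).
    apply/seteqP; split=> u /= h i.
      by have := h ((s^-1)%g i); rewrite tnth_mktuple permKV.
    by rewrite tnth_mktuple; have := h (s i); rewrite permK.
  by rewrite mpow_box// [in RHS](reindex_perm (s^-1)%g).
Qed.

Lemma measurable_cat n m :
  measurable_fun setT (fun p : n.-tuple T * m.-tuple T => [tuple of p.1 ++ p.2]).
Proof.
apply/measurable_fun_tnthP => i.
case: (split_ordP i) => j ->.
  rewrite (_ : _ \o _ = (fun t => tnth t j) \o fst).
    by apply: measurableT_comp => //; exact: measurable_tnth.
  by apply/funext => t /=; rewrite tnth_lshift.
rewrite (_ : _ \o _ = (fun t => tnth t j) \o snd).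
  by apply: measurableT_comp => //; exact: measurable_tnth.
by apply/funext => t /=; rewrite tnth_rshift.
Qed.

Lemma mpow_cat n m A : measurable A ->
  (mpow mu n \x mpow mu m)%E ((fun p : n.-tuple T * m.-tuple T => [tuple of p.1 ++ p.2]) @^-1` A)
  = mpow mu (n + m) A.
Proof.
move=> mA.
pose m1 := measure_function_pushforward__canonical__measure_function_Measure
     (mpow mu n \x mpow mu m)%E (@measurable_cat n m).
rewrite -[LHS]/(m1 A); apply/esym; apply: tuple_measure_eq => //; first exact: mpow_fin.
move=> {mA} {}A mA; rewrite [LHS](mpow_box mA) /m1 /= /pushforward.
have -> : (fun p : n.-tuple T * m.-tuple T => [tuple of p.1 ++ p.2]) @^-1` box A =
    box (fun i => A (lshift m i)) `*` box (fun i => A (rshift n i)).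
  apply/seteqP; split=> -[u v] /=.
    by move=> h; split=> i; [have := h (lshift m i)|have := h (rshift n i)];
      rewrite ?tnth_lshift ?tnth_rshift.
  move=> [hu hv] i; case: (split_ordP i) => j ->.
    by rewrite tnth_lshift; exact: hu.
  by rewrite tnth_rshift; exact: hv.
rewrite product_measure1E; [|exact: measurable_box..].
rewrite [X in (_ * X)%E](mpow_box (fun i => mA (rshift n i))).
by rewrite [X in (X * _)%E](mpow_box (fun i => mA (lshift m i))) -EFinM big_split_ord.
Qed.

Lemma mpow_setT n : fine (mpow mu n setT) = fine (mu setT) ^+ n.
Proof.
have -> : [set: n.-tuple T] = box (fun=> setT) by apply/seteqP; split.
by rewrite mpow_box//= prodr_const card_ord.
Qed.

End tuple_measures.

(** * Square-integrable functions, Bessel and Parseval *)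

Section L2_space.
Context d (T : measurableType d) (R : realType) (mu : {finite_measure set T -> \bar R}).
Implicit Types f g : T -> R.
Local Notation dot := (dotL2 mu).

Lemma L2_measurable f : L2 mu f -> measurable_fun setT f.
Proof. by rewrite /L2 /= inE => /andP[/[!inE]/=]. Qed.

Lemma L2_mul_integ f g : L2 mu f -> L2 mu g -> integ mu (fun x => f x * g x).
Proof. by move=> Lf Lg; have /Lfun1_integrable := Lfun2_mul_Lfun1 Lf Lg. Qed.

Lemma L2_integ f : L2 mu f -> integ mu f.
Proof.
move=> Lf; apply/Lfun1_integrable; apply: Lfun_subset12 => //.
exact: fin_num_measure.
Qed.

(** Turns the power 2 of the L2 norm, a real power, into an ordinary square.
    *)
Lemma L2_of_sqr_integ f : measurable_fun setT f -> integ mu (fun x => f x ^+ 2) -> L2 mu f.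
Proof.
move=> mf /integrableP[_ h]; rewrite /L2 /= inE; apply/andP; split; rewrite inE//=.
rewrite /finite_norm unlock /=; apply: poweR_lty.
apply: le_lt_trans h; rewrite le_eqVlt; apply/orP; left; apply/eqP.
by apply: eq_integral => x _ /=; rewrite powR_mulrn// normrX.
Qed.

Lemma L2_bounded f M : measurable_fun setT f -> (forall x, `|f x| <= M) -> L2 mu f.
Proof.
move=> mf fM; apply: L2_of_sqr_integ => //; apply: (@integ_bounded _ _ _ _ _ (M ^+ 2)).
  exact: measurable_funX.
by move=> x; rewrite normrX ler_pXn2r// ?nnegrE// (le_trans _ (fM x)).
Qed.

Lemma L2_add f g : L2 mu f -> L2 mu g -> L2 mu (fun x => f x + g x).
Proof.
move=> Lf Lg; apply: L2_of_sqr_integ.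
  by apply: measurable_funD; exact: L2_measurable.
have -> : (fun x => (f x + g x) ^+ 2) =
    (fun x => (f x * f x + 2 * (f x * g x)) + g x * g x).
  by apply/funext => x; ring.
by apply: integD; [apply: integD|]; [|apply: integZ|]; exact: L2_mul_integ.
Qed.

Lemma L2_scale (c : R) f : L2 mu f -> L2 mu (fun x => c * f x).
Proof.
move=> Lf; apply: L2_of_sqr_integ.
  by apply: measurable_funM => //; exact: L2_measurable.
have -> : (fun x => (c * f x) ^+ 2) = (fun x => (c ^+ 2) * (f x * f x)).
  by apply/funext => x; ring.
by apply: integZ; exact: L2_mul_integ.
Qed.

Lemma L2_sub f g : L2 mu f -> L2 mu g -> L2 mu (fun x => f x - g x).
Proof.
move=> Lf Lg; have -> : (fun x => f x - g x) = (fun x => f x + (-1) * g x).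
  by apply/funext => x; rewrite mulN1r.
by apply: L2_add => //; exact: L2_scale.
Qed.

Lemma L2_sum (I : Type) (s : seq I) (F : I -> T -> R) : (forall i, L2 mu (F i)) ->
  L2 mu (fun x => \sum_(i <- s) F i x).
Proof.
move=> LF; elim: s => [|i s IH].
  apply: (@L2_bounded _ 0) => [|x]; last by rewrite big_nil normr0.
  rewrite (_ : (fun x => _) = cst 0); first exact: measurable_cst.
  by apply/funext => x; rewrite big_nil.
by under eq_fun => x do rewrite big_cons; exact: L2_add.
Qed.

Lemma dotC f g : dot f g = dot g f.
Proof. by apply: eq_Rintegral => x _; rewrite mulrC. Qed.

Lemma dot_add f g h : L2 mu f -> L2 mu g -> L2 mu h ->
  dot (fun x => f x + g x) h = dot f h + dot g h.
Proof.
move=> Lf Lg Lh; rewrite /dotL2 -RintegralD//; try exact: L2_mul_integ.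
by apply: eq_Rintegral => x _; rewrite mulrDl.
Qed.

Lemma dot_sub f g h : L2 mu f -> L2 mu g -> L2 mu h ->
  dot (fun x => f x - g x) h = dot f h - dot g h.
Proof.
move=> Lf Lg Lh; rewrite /dotL2 -RintegralB//; try exact: L2_mul_integ.
by apply: eq_Rintegral => x _; rewrite mulrBl.
Qed.

Lemma dot_scale (c : R) f h : L2 mu f -> L2 mu h ->
  dot (fun x => c * f x) h = c * dot f h.
Proof.
move=> Lf Lh; rewrite /dotL2 -RintegralZl//; try exact: L2_mul_integ.
by apply: eq_Rintegral => x _; rewrite mulrA.
Qed.

Lemma dot_sum (I : Type) (s : seq I) (F : I -> T -> R) h :
  (forall i, L2 mu (F i)) -> L2 mu h ->
  dot (fun x => \sum_(i <- s) F i x) h = \sum_(i <- s) dot (F i) h.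
Proof.
move=> LF Lh; rewrite /dotL2 -Rintegral_sum; last first.
  by move=> i; exact: L2_mul_integ.
by apply: eq_Rintegral => x _; rewrite mulr_suml.
Qed.

Lemma dot_ge0 f : 0 <= dot f f.
Proof. by apply: Rintegral_ge0 => x _; exact: sqr_ge0. Qed.

Lemma dot_sub_sub f g : L2 mu f -> L2 mu g ->
  dot (fun x => f x - g x) (fun x => f x - g x) = dot f f - 2 * dot f g + dot g g.
Proof.
move=> Lf Lg; have Lfg := L2_sub Lf Lg.
rewrite dot_sub// (dotC f) (dotC g) !dot_sub// (dotC g f); ring.
Qed.

Section orthonormal.
Context (I : eqType) (e : I -> T -> R).
Hypothesis Le : forall i, L2 mu (e i).
Hypothesis oe : forall i j, dot (e i) (e j) = (i == j)%:R.

(** For an orthonormal family this is the projection of g on the span of the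
    functions indexed by s. *)
Definition fourier_sum (g : T -> R) (s : seq I) : T -> R :=
  fun x => \sum_(i <- s) dot g (e i) * e i x.

Lemma L2_fourier_sum g s : L2 mu (fourier_sum g s).
Proof. by apply: L2_sum => i; exact: L2_scale. Qed.

Lemma dot_fourier_sum g s i : uniq s ->
  dot (fourier_sum g s) (e i) = if i \in s then dot g (e i) else 0.
Proof.
move=> us; rewrite /fourier_sum dot_sum//; last by move=> j; exact: L2_scale.
under eq_bigr => j _ do rewrite dot_scale// oe.
case: ifPn => si.
  rewrite (bigD1_seq i)//= eqxx mulr1 big1 ?addr0// => j ji.
  by rewrite (negbTE ji) mulr0.
rewrite big_seq big1// => j js; case: eqP => [ji|]; last by rewrite mulr0.
by rewrite -ji js in si.
Qed.

Lemma dot_fourier_sum2 g s t : uniq s -> uniq t -> {subset t <= s} ->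
  dot (fourier_sum g s) (fourier_sum g t) = \sum_(i <- t) dot g (e i) ^+ 2.
Proof.
move=> us ut ts; rewrite dotC {1}/fourier_sum dot_sum//; last 2 first.
- by move=> j; exact: L2_scale.
- exact: L2_fourier_sum.
rewrite big_seq [RHS]big_seq; apply: eq_bigr => i it.
rewrite dot_scale//; last exact: L2_fourier_sum.
by rewrite (dotC (e i)) dot_fourier_sum// ts// expr2.
Qed.

Lemma dot_fourier_residual g s : L2 mu g -> uniq s ->
  dot (fun x => g x - fourier_sum g s x) (fun x => g x - fourier_sum g s x) =
  dot g g - \sum_(i <- s) dot g (e i) ^+ 2.
Proof.
move=> Lg us; rewrite dot_sub_sub//; last exact: L2_fourier_sum.
rewrite dot_fourier_sum2//.
have -> : dot g (fourier_sum g s) = \sum_(i <- s) dot g (e i) ^+ 2.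
  rewrite dotC /fourier_sum dot_sum//; last by move=> j; exact: L2_scale.
  by apply: eq_bigr => i _; rewrite dot_scale// dotC expr2.
ring.
Qed.

Lemma bessel g s : L2 mu g -> uniq s -> \sum_(i <- s) dot g (e i) ^+ 2 <= dot g g.
Proof. by move=> Lg us; rewrite -subr_ge0 -dot_fourier_residual// dot_ge0. Qed.

End orthonormal.

(** The completeness of L2, for sequences with geometric Cauchy bounds. The
    increments are summable in L1, hence absolutely summable almost
    everywhere, which gives an almost everywhere limit; Fatou's lemma
    transfers the bounds on the differences to it. *)
Lemma L2_fast_cauchy_cvg (s : nat -> T -> R) : (forall n, L2 mu (s n)) ->
  (forall n m, (n <= m)%N ->
    dot (fun x => s m x - s n x) (fun x => s m x - s n x) <= 4^-1 ^+ n) ->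
  exists2 f, L2 mu f & forall n, dot (fun x => f x - s n x) (fun x => f x - s n x) <= 4^-1 ^+ n.
Proof.
move=> Ls sC.
pose h n x := s n.+1 x - s n x.
have Lh n : L2 mu (h n) by exact: L2_sub.
have mh n : measurable_fun setT (h n) := L2_measurable (Lh n).
pose C : R := 1 + fine (mu setT).
have C0 : 0 <= C by rewrite addr_ge0// fine_ge0.
have hC n : (\int[mu]_x `|h n x|%:E <= (2^-1 ^+ n * C)%:E)%E.
  have ih := integrable_norm (L2_integ (Lh n)).
  have -> : (\int[mu]_x `|h n x|%:E = (\int[mu]_x `|h n x|)%:E)%E.
    by rewrite fineK//; exact: integrable_fin_num.
  rewrite lee_fin.
  apply: (@le_trans _ _ (\int[mu]_x (2 ^+ n * (h n x * h n x) + 2^-1 ^+ n))).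
    apply: le_Rintegral => //.
      apply: integD; first by apply: integZ; exact: L2_mul_integ.
      exact: finite_measure_integrable_cst.
    move=> x _; have p2 : 0 < 2 ^+ n :> R by rewrite exprn_gt0.
    rewrite -(ler_pM2l p2) mulrDr exprVn mulfV ?gt_eqF//.
    have -> : 2 ^+ n * (2 ^+ n * (h n x * h n x)) = (2 ^+ n * `|h n x|) ^+ 2.
      by rewrite exprMn real_normK ?num_real// !expr2 mulrA.
    (* |h| <= 2^n h^2 + 2^-n, by the inequality of the two means *)
    set q := 2 ^+ n * _; have : 0 <= (q - 2^-1) ^+ 2 by exact: sqr_ge0.
    by nra.
  rewrite RintegralD//; last 2 first.
  - by apply: integZ; exact: L2_mul_integ.
  - exact: finite_measure_integrable_cst.
  rewrite RintegralZl//; last exact: L2_mul_integ.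
  rewrite Rintegral_cst// mulrDr mulr1; apply: lerD => //.
  have -> : (2^-1 ^+ n : R) = 2 ^+ n * 4^-1 ^+ n.
    by rewrite -exprMn; congr (_ ^+ _); lra.
  by apply: ler_wpM2l; [rewrite exprn_ge0|exact: sC].
pose H x := (\sum_(0 <= n <oo) `|h n x|%:E)%E.
have mH : measurable_fun setT H.
  apply: ge0_emeasurable_sum => [k x _ _|k _]; first by rewrite lee_fin.
  by apply/measurable_EFinP; exact: measurableT_comp.
have Hfin : {ae mu, forall x, H x \is a fin_num}.
  suff : mu.-integrable setT H.
    by move=> /(integrable_ae measurableT); apply: filterS => x; exact.
  apply/integrableP; split=> //.
  have -> : (\int[mu]_x `|H x| = \int[mu]_x H x)%E.
    apply: eq_integral => x _; rewrite gee0_abs//.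
    by apply: nneseries_ge0 => n _ _; rewrite lee_fin.
  rewrite integral_nneseries//; last first.
    by move=> n; apply/measurable_EFinP; exact: measurableT_comp.
  apply: (@le_lt_trans _ _ (2 * C)%:E); last exact: ltry.
  apply: lime_le.
    by apply: is_cvg_nneseries => n _ _; exact: integral_ge0.
  apply: nearW => n.
  apply: (@le_trans _ _ (\sum_(0 <= k < n) (2^-1 ^+ k * C)%:E)%E).
    by apply: lee_sum => k _; exact: hC.
  rewrite sumEFin lee_fin -mulr_suml; apply: ler_wpM2r => //.
  have -> : \sum_(0 <= k < n) 2^-1 ^+ k = 2 - 2 * 2^-1 ^+ n :> R.
    elim: n => [|n IH]; first by rewrite big_geq// expr0; lra.
    by rewrite big_nat_recr//= IH exprS; lra.
  by rewrite gerBl mulr_ge0// exprn_ge0.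
(* an upper limit is measurable, and it is the limit where that exists *)
pose f x := fine (limn_esup (fun n => (s n x)%:E)).
have mf : measurable_fun setT f.
  apply: (measurableT_comp (fine_measurable measurableT)).
  apply: measurable_fun_limn_esup => n.
  by apply/measurable_EFinP; exact: L2_measurable.
have scvg : {ae mu, forall x, s n x @[n --> \oo] --> f x}.
  apply: filterS Hfin => x Hx.
  have : cvgn [normed series (h ^~ x)].
    apply: nondecreasing_is_cvgn; first by apply: nondecreasing_series => k _ _; exact: normr_ge0.
    exists (fine (H x)) => _ [n _ <-]; rewrite -lee_fin fineK// /= -sumEFin.
    by apply: nneseries_lim_ge => k _ _; rewrite lee_fin.
  move=> /normed_cvg cS.
  have cs : cvgn (s ^~ x).
    have -> : s ^~ x = (fun n => s 0%N x + series (h ^~ x) n).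
      by apply/funext => n; rewrite (eq_sum_telescope (s ^~ x)).
    by apply: is_cvgD => //; exact: is_cvg_cst.
  rewrite /f; have /cvg_ex[l sl] := cs.
  have sl' : (fun n => (s n x)%:E) @ \oo --> l%:E.
    by apply: cvg_EFin => //; exact: nearW.
  by rewrite (cvg_limn_einf_sup sl').2.
have fatou_bound n : (\int[mu]_x ((f x - s n x) ^+ 2)%:E <= (4^-1 ^+ n)%:E)%E.
  pose u m x := ((s (n + m)%N x - s n x) ^+ 2)%:E.
  have mu_ m : measurable_fun setT (u m).
    apply/measurable_EFinP; apply: measurable_funX.
    by apply: measurable_funB; exact: L2_measurable.
  have u0 m x : setT x -> (0 <= u m x)%E by rewrite lee_fin sqr_ge0.
  have -> : (\int[mu]_x ((f x - s n x) ^+ 2)%:E =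
             \int[mu]_x limn_einf (u ^~ x))%E.
    apply: ae_eq_integral => //.
    - apply/measurable_EFinP; apply: measurable_funX.
      by apply: measurable_funB => //; exact: L2_measurable.
    - have -> : (fun x => limn_einf (u ^~ x)) =
          (fun x => - limn_esup (fun n => - (u n x)))%E.
        by apply/funext => x; rewrite limn_esupN oppeK.
      apply: measurableT_comp => //; apply: measurable_fun_limn_esup => m.
      exact: measurableT_comp.
    - apply: filterS scvg => x sx _.
      have : (u ^~ x) @ \oo --> ((f x - s n x) ^+ 2)%:E.
        apply: cvg_EFin; first exact: nearW.
        have sx' : s (n + m)%N x @[m --> \oo] --> f x.
          by under eq_fun do rewrite addnC; have := sx; rewrite -(cvg_shiftn n (s ^~ x)).
        have -> : fine \o u ^~ x =
            (fun m => (s (n + m)%N x - s n x) * (s (n + m)%N x - s n x)).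
          by apply/funext => m; rewrite /u /= expr2.
        by rewrite expr2; apply: cvgM; apply: cvgB => //; exact: cvg_cst.
      by move=> /cvg_limn_einf_sup[-> _].
  apply: le_trans (fatou mu measurableT mu_ u0) _.
  rewrite limn_einf_lim; apply: lime_le; first exact: is_cvg_einfs.
  apply: nearW => m.
  apply: (@le_trans _ _ (\int[mu]_x u m x)%E).
    by apply: ereal_inf_lbound; exists m => /=.
  have Lu : L2 mu (fun x => s (n + m)%N x - s n x) by exact: L2_sub.
  have := sC n (n + m)%N (leq_addr _ _); rewrite -lee_fin; apply: le_trans.
  rewrite /dotL2 /Rintegral fineK; last first.
    by apply: integrable_fin_num => //; exact: L2_mul_integ.
  rewrite le_eqVlt; apply/orP; left; apply/eqP.
  by apply: eq_integral => x _; rewrite /u expr2.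
have Lfs n : L2 mu (fun x => f x - s n x).
  apply: L2_of_sqr_integ; first by apply: measurable_funB => //; exact: L2_measurable.
  apply/integrableP; split.
    apply/measurable_EFinP; apply: measurable_funX.
    by apply: measurable_funB => //; exact: L2_measurable.
  apply: le_lt_trans (ltry (4^-1 ^+ n)).
  apply: le_trans (fatou_bound n); rewrite le_eqVlt; apply/orP; left; apply/eqP.
  by apply: eq_integral => x _ /=; rewrite ger0_norm// sqr_ge0.
exists f => [|n].
  have -> : f = (fun x => (f x - s 0%N x) + s 0%N x) by apply/funext => x; rewrite subrK.
  exact: L2_add.
rewrite -lee_fin /dotL2 /Rintegral fineK; last first.
  by apply: integrable_fin_num => //; exact: L2_mul_integ.
apply: le_trans (fatou_bound n); rewrite le_eqVlt; apply/orP; left; apply/eqP.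
by apply: eq_integral => x _; rewrite expr2.
Qed.

(** Parseval's identity without infinite sums. Take finite index sets whose
    sums of squared coefficients approach their supremum. The partial sums are
    then a fast Cauchy sequence, its limit has the same coefficients as g, and
    the maximality of the basis identifies the limit with g. *)
Lemma parseval_approx (I : choiceType) (e : I -> T -> R) (g : T -> R) (eps : R) :
  orthonormal_basis mu e -> L2 mu g -> 0 < eps ->
  exists2 s : seq I, uniq s & dot g g - eps <= \sum_(i <- s) dot g (e i) ^+ 2.
Proof.
move=> [Le oe ce] Lg eps0.
pose c i := dot g (e i) ^+ 2.
pose E : set R := [set \sum_(i <- s) c i | s in [set s : seq I | uniq s]].
have hE : has_sup E.
  split; first by exists 0; exists [::] => //; rewrite big_nil.
  by exists (dot g g) => _ [s us <-]; exact: bessel.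
have step (n : nat) : exists s : seq I, uniq s /\ sup E - 4^-1 ^+ n < \sum_(i <- s) c i.
  have e0 : 0 < 4^-1 ^+ n :> R by rewrite exprn_gt0// invr_gt0.
  have [x [s us <-] hs] := sup_adherent e0 hE.
  by exists s.
have [F hF] := choice step.
(* the F n need not be nested; the G n are *)
pose G := fix G n := if n is n'.+1 then undup (F n ++ G n') else F 0%N.
have uG n : uniq (G n) by case: n => [|n] /=; [have [] := hF 0%N|exact: undup_uniq].
have GS n m : (n <= m)%N -> {subset G n <= G m}.
  elim: m => [|m IH]; first by rewrite leqn0 => /eqP->.
  rewrite leq_eqVlt => /orP[/eqP->//|]; rewrite ltnS => /IH nm i /nm im.
  by rewrite /= mem_undup mem_cat im orbT.
have supE t : uniq t -> \sum_(i <- t) c i <= sup E.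
  by move=> ut; apply: sup_upper_bound => //; exists t.
have Gsup n : \sum_(i <- G n) c i <= sup E by exact: supE.
have subsum s t : uniq s -> uniq t -> {subset s <= t} ->
    \sum_(i <- s) c i <= \sum_(i <- t) c i.
  move=> us ut st.
  have -> : \sum_(i <- t) c i = \sum_(i <- t | i \in s) c i + \sum_(i <- t | i \notin s) c i.
    by rewrite (bigID (fun i => i \in s)).
  have -> : \sum_(i <- t | i \in s) c i = \sum_(i <- s) c i.
    rewrite -big_filter; apply: perm_big; apply: uniq_perm => //.
      exact: filter_uniq.
    move=> i; rewrite mem_filter; case: (boolP (i \in s)) => // /st ->//.
  by rewrite lerDl sumr_ge0// => i _; exact: sqr_ge0.
have Glow n : sup E - 4^-1 ^+ n <= \sum_(i <- G n) c i.
  have [uF hFn] := hF n; apply: (le_trans (ltW hFn)); apply: subsum => // i iF.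
  by case: n iF {uF hFn} => [|n] iF //=; rewrite mem_undup mem_cat iF.
have [f Lf hf] : exists2 f, L2 mu f & forall n,
    dot (fun x => f x - fourier_sum e g (G n) x) (fun x => f x - fourier_sum e g (G n) x) <= 4^-1 ^+ n.
  apply: L2_fast_cauchy_cvg => [n|n m nm]; first exact: L2_fourier_sum.
  rewrite dot_sub_sub; try exact: L2_fourier_sum.
  rewrite !dot_fourier_sum2//; last exact: GS.
  have := Glow n; have := Gsup m; rewrite /c; lra.
have Lgf : L2 mu (fun x => g x - f x) by exact: L2_sub.
(* an index outside all G n has coefficient 0, as adding it to G n would
   exceed the supremum *)
have gf0 i : dot (fun x => g x - f x) (e i) = 0.
  have bound n : dot (fun x => g x - f x) (e i) ^+ 2 <= 4 * 4^-1 ^+ n.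
    have Ls := L2_fourier_sum Le g (G n).
    set S := fourier_sum e g (G n) in Ls.
    have -> : dot (fun x => g x - f x) (e i) =
        dot (fun x => g x - S x) (e i) - dot (fun x => f x - S x) (e i).
      by rewrite !dot_sub//; ring.
    have h1 : dot (fun x => g x - S x) (e i) ^+ 2 <= 4^-1 ^+ n.
      rewrite dot_sub// dot_fourier_sum//; case: ifPn => iG.
        by rewrite subrr expr0n /= exprn_ge0.
      rewrite subr0.
      have : \sum_(j <- i :: G n) c j <= sup E.
        by apply: supE; rewrite /= iG uG.
      by rewrite big_cons -/(c i); have := Glow n; lra.
    have h2 : dot (fun x => f x - S x) (e i) ^+ 2 <= 4^-1 ^+ n.
      have := @bessel _ e Le oe (fun x => f x - S x) [:: i] (L2_sub Lf Ls) erefl.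
      by rewrite big_seq1 => /le_trans; apply; exact: hf.
    have := sqr_ge0 (dot (fun x => g x - S x) (e i) + dot (fun x => f x - S x) (e i)).
    move: h1 h2; rewrite sqrrB sqrrD !mulr2n; lra.
  apply/eqP; rewrite -sqrf_eq0 eq_le sqr_ge0 andbT.
  have c4 : (4 : R) * 4^-1 ^+ n @[n --> \oo] --> 0.
    have := @cvg_geometric R 4 4^-1; apply.
    by rewrite ger0_norm// invf_lt1// ltr1n.
  rewrite -(cvg_lim (@Rhausdorff R) c4); apply: limr_ge; first by apply: cvgP c4.
  exact: nearW.
have gf : g = f %[ae mu].
  have := ce _ Lgf gf0; apply: filterS => x h xT; apply/eqP.
  by rewrite -subr_eq0; apply/eqP; exact: h.
have [n hn] : exists n : nat, 4^-1 ^+ n <= eps.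
  have c4 : (4^-1 : R) ^+ n @[n --> \oo] --> 0.
    by apply: cvg_expr; rewrite ger0_norm// invf_lt1// ltr1n.
  have /cvgrPdist_le/(_ _ eps0)[N _ hN] := c4.
  exists N; have := hN N (leqnn _); rewrite /= sub0r normrN; apply: le_trans.
  exact: ler_norm.
exists (G n) => //.
have := hf n.
have -> : dot (fun x => f x - fourier_sum e g (G n) x) (fun x => f x - fourier_sum e g (G n) x)
    = dot (fun x => g x - fourier_sum e g (G n) x) (fun x => g x - fourier_sum e g (G n) x).
  have Ls := L2_fourier_sum Le g (G n).
  rewrite /dotL2 /Rintegral; congr fine; apply: ae_eq_integral => //.
  - by have := L2_mul_integ (L2_sub Lf Ls) (L2_sub Lf Ls); exact: measurable_int.
  - by have := L2_mul_integ (L2_sub Lg Ls) (L2_sub Lg Ls); exact: measurable_int.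
  - by apply: filterS gf => x + xT => ->.
rewrite dot_fourier_residual//; move: hn; lra.
Qed.

End L2_space.

(** * Positive semidefinite kernels *)

Section psd.
Context (R : realType) (X : Type).
Implicit Types K : X -> X -> R.

(** Lists of weighted points are easier to extend by one point than families
    indexed by ordinals. *)
Lemma psd_kernel_seq K : psd_kernel K -> forall s : seq (R * X),
  0 <= \sum_(a <- s) \sum_(b <- s) a.1 * b.1 * K a.2 b.2.
Proof.
move=> psdK s.
have := psdK (size s) (fun i => (tnth (in_tuple s) i).2) (fun i => (tnth (in_tuple s) i).1).
congr (_ <= _); rewrite [RHS]big_tnth; apply: eq_bigr => i _.
by rewrite [RHS]big_tnth.
Qed.

Lemma psd_seq_kernel K : (forall s : seq (R * X),
  0 <= \sum_(a <- s) \sum_(b <- s) a.1 * b.1 * K a.2 b.2) -> psd_kernel K.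
Proof.
move=> h n x c; have := h [seq (c i, x i) | i <- enum 'I_n].
rewrite big_map big_enum/=.
by under eq_bigr => i _ do rewrite big_map big_enum/=.
Qed.

Lemma psd_diag_ge0 K x : psd_kernel K -> 0 <= K x x.
Proof.
move=> psdK; have := psd_kernel_seq psdK [:: (1, x)].
by rewrite !big_seq1 !mul1r.
Qed.

Lemma psd_pair K x y (a b : R) : psd_kernel K -> (forall x y, K x y = K y x) ->
  0 <= a ^+ 2 * K x x + 2 * a * b * K x y + b ^+ 2 * K y y.
Proof.
move=> psdK symK; have := psd_kernel_seq psdK [:: (a, x); (b, y)].
rewrite !big_cons !big_nil/= (symK y x).
congr (_ <= _); ring.
Qed.

Lemma psd_cauchy_schwarz K x y : psd_kernel K -> (forall x y, K x y = K y x) ->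
  K x y ^+ 2 <= K x x * K y y.
Proof.
move=> psdK symK.
have := psd_pair x y (K x y) (- K x x) psdK symK.
have := psd_diag_ge0 x psdK; rewrite le_eqVlt => /orP[/eqP K0 _|K0].
  rewrite -K0 mul0r.
  (* these weights give - (K y y + 2) * (K x y) ^+ 2 *)
  have := psd_pair x y (- (K y y + 1)) (K x y) psdK symK; rewrite -K0.
  have := psd_diag_ge0 y psdK; nra.
move=> h; rewrite -(ler_pM2l K0); move: h; nra.
Qed.

(** One step of a Cholesky decomposition, the Schur complement at x0: the
    quadratic form of the new kernel is the minimum of that of K over the
    weight given to the extra point x0. If K x0 x0 = 0, the correction
    vanishes by the convention 0^-1 = 0. *)
Lemma psd_pivot K x0 : psd_kernel K -> (forall x y, K x y = K y x) ->
  psd_kernel (fun x y => K x y - K x x0 * K y x0 / K x0 x0).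
Proof.
move=> psdK symK; apply: psd_seq_kernel => s.
set L := \sum_(a <- s) a.1 * K a.2 x0.
pose Q := \sum_(a <- s) \sum_(b <- s) a.1 * b.1 * K a.2 b.2.
have -> : \sum_(a <- s) \sum_(b <- s)
    a.1 * b.1 * (K a.2 b.2 - K a.2 x0 * K b.2 x0 / K x0 x0) =
    Q - L ^+ 2 / K x0 x0.
  rewrite /L expr2 mulr_suml mulr_suml /Q -sumrB; apply: eq_bigr => a _.
  rewrite mulr_sumr mulr_suml -sumrB; apply: eq_bigr => b _; ring.
(* the weight of x0 that minimizes the quadratic form *)
have := psd_kernel_seq psdK ((- L / K x0 x0, x0) :: s).
rewrite !big_cons/=.
under [X in _ + X]eq_bigr => a _ do rewrite big_cons/=.
rewrite big_split/= -/Q.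
have -> : \sum_(j <- s) - L / K x0 x0 * j.1 * K x0 j.2 = - L ^+ 2 / K x0 x0.
  transitivity (- L / K x0 x0 * L); last by ring.
  rewrite {3}/L mulr_sumr; apply: eq_bigr => a _; rewrite (symK x0 a.2); ring.
have -> : \sum_(i <- s) i.1 * (- L / K x0 x0) * K i.2 x0 = - L ^+ 2 / K x0 x0.
  transitivity (- L / K x0 x0 * L); last by ring.
  rewrite {3}/L mulr_sumr; apply: eq_bigr => a _; ring.
have [K0|K0] := eqVneq (K x0 x0) 0.
  by rewrite K0 invr0 !mulr0 !add0r subr0.
have -> : - L / K x0 x0 * (- L / K x0 x0) * K x0 x0 = L ^+ 2 / K x0 x0 by field.
by congr (_ <= _); ring.
Qed.

End psd.

Section psd_constructions.
Context (R : realType).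

(** In a Hilbert space realization of K this is the Gram matrix of the vectors
    of x and y, each translated by t times the vector of [None]. *)
Lemma psd_option_shift (X : Type) (K : option X -> option X -> R) (t : R) :
  psd_kernel K -> (forall a b, K a b = K b a) ->
  psd_kernel (fun x y => K (Some x) (Some y)
    + t * (K (Some x) None + K (Some y) None) + t ^+ 2 * K None None).
Proof.
move=> psdK symK; apply: psd_seq_kernel => s.
set C := \sum_(a <- s) a.1.
(* each translation by t contributes its weight to the point [None] *)
have := psd_kernel_seq psdK ((t * C, None) :: [seq (a.1, Some a.2) | a <- s]).
rewrite !big_cons/= !big_map.
under [X in _ + X]eq_bigr => a _ do rewrite big_cons big_map/=.
set L := \sum_(a <- s) a.1 * K (Some a.2) None.
set Q := \sum_(a <- s) \sum_(b <- s) a.1 * b.1 * K (Some a.2) (Some b.2).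
rewrite big_split/= -/Q.
have -> : \sum_(j <- s) t * C * j.1 * K None (Some j.2) = t * C * L.
  rewrite /L mulr_sumr; apply: eq_bigr => a _; rewrite (symK None); ring.
have -> : \sum_(i <- s) i.1 * (t * C) * K (Some i.2) None = t * C * L.
  rewrite /L mulr_sumr; apply: eq_bigr => a _; ring.
move=> h; suff -> : \sum_(a <- s) \sum_(b <- s) a.1 * b.1 * (K (Some a.2) (Some b.2)
    + t * (K (Some a.2) None + K (Some b.2) None) + t ^+ 2 * K None None) =
    t * C * (t * C) * K None None + t * C * L + (t * C * L + Q) by [].
have -> : t * C * (t * C) * K None None + t * C * L + (t * C * L + Q) =
    Q + (t * (L * C) + t * (C * L)) + C * C * (t ^+ 2 * K None None) by ring.
rewrite /Q {2}/L /C !mulr_suml !mulr_sumr -!big_split/=; apply: eq_bigr => a _.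
rewrite !mulr_sumr !mulr_suml -!big_split/=; apply: eq_bigr => b _; ring.
Qed.

Lemma psd_comp (X Y : Type) (K : Y -> Y -> R) (f : X -> Y) :
  psd_kernel K -> psd_kernel (fun x y => K (f x) (f y)).
Proof. by move=> psdK n x c; exact: psdK. Qed.

Lemma psd_scale (X : Type) (K : X -> X -> R) (a : R) : 0 <= a ->
  psd_kernel K -> psd_kernel (fun x y => a * K x y).
Proof.
move=> a0 psdK n x c; have := mulr_ge0 a0 (psdK n x c).
congr (_ <= _); rewrite mulr_sumr; apply: eq_bigr => i _.
by rewrite mulr_sumr; apply: eq_bigr => j _; ring.
Qed.

Lemma psd_Rintegral d (T : measurableType d) (nu : {finite_measure set T -> \bar R})
    (X : Type) (K : T -> X -> X -> R) :
  (forall w, psd_kernel (K w)) -> (forall x y, integ nu (fun w => K w x y)) ->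
  psd_kernel (fun x y => \int[nu]_w K w x y).
Proof.
move=> psdK intK n x c.
have -> : \sum_(i < n) \sum_(j < n) c i * c j * \int[nu]_w K w (x i) (x j) =
    \int[nu]_w (\sum_(i < n) \sum_(j < n) c i * c j * K w (x i) (x j)).
  rewrite Rintegral_sum; last by move=> i; apply: integ_sum => j; exact: integZ.
  apply: eq_bigr => i _; rewrite Rintegral_sum; last by move=> j; exact: integZ.
  by apply: eq_bigr => j _; rewrite RintegralZl.
by apply: Rintegral_ge0 => w _; exact: psdK.
Qed.

End psd_constructions.

(** * Mercer's trace formula *)

Section mercer.
Context d (V : borelType d) (R : realType) (cV : compact [set: V]).
Context (mu : {finite_measure set V -> \bar R}).
Implicit Types K : V -> V -> R.

Definition mercer_kernel K := [/\ continuous (fun p : V * V => K p.1 p.2),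
  psd_kernel K & forall x y, K x y = K y x].

Lemma continuous_section K x : continuous (fun p : V * V => K p.1 p.2) ->
  continuous (fun y => K y x).
Proof.
move=> cK y; apply: (@continuous_comp _ _ _ (fun y => (y, x)) (fun p : V * V => K p.1 p.2)).
  by apply: cvg_pair; [exact: cvg_id|exact: cvg_cst].
exact: cK.
Qed.

Arguments continuous_section K x : clear implicits.

Lemma continuous_diag K : continuous (fun p : V * V => K p.1 p.2) ->
  continuous (fun y => K y y).
Proof.
move=> cK y; apply: (@continuous_comp _ _ _ (fun y => (y, y)) (fun p : V * V => K p.1 p.2)).
  by apply: cvg_pair; exact: cvg_id.
exact: cK.
Qed.

(** After pivoting at the points of a net the remainder S vanishes at these
    points. The distance sqrt (K x x + K y y - 2 K x y) attached to a kernel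
    only decreases when a positive semidefinite kernel is subtracted, so S x x
    is at most the squared K-distance of x to the net. *)
Lemma psd_finite_rank K (eps : R) : mercer_kernel K -> 0 < eps ->
  exists n (g : nat -> V -> R) (S : V -> V -> R),
  [/\ forall i, continuous (g i), mercer_kernel S,
      forall x y, K x y = \sum_(i < n) g i x * g i y + S x y &
      forall x, S x x <= eps].
Proof.
move=> cK eps0.
have dec (s : seq V) : exists n (g : nat -> V -> R) (S : V -> V -> R),
  [/\ forall i, continuous (g i), mercer_kernel S,
      forall x y, K x y = \sum_(i < n) g i x * g i y + S x y &
      forall x, x \in s -> S x x = 0].
  elim: s => [|x0 s [n [g [S [cg [cS psdS symS] KE S0]]]]].
    exists 0%N, (fun _ _ => 0), K; split=> //.
      by move=> i x; exact: cst_continuous.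
    by move=> x y; rewrite big_ord0 add0r.
  pose g0 x := S x x0 / Num.sqrt (S x0 x0).
  have g0E x y : g0 x * g0 y = S x x0 * S y x0 / S x0 x0.
    rewrite /g0 mulrACA -invfM -expr2 sqr_sqrtr//; exact: psd_diag_ge0.
  have cg0 : continuous g0.
    move=> x; apply: cvgM; last exact: cvg_cst.
    exact: (continuous_section _ x0 cS).
  exists n.+1, (fun i => if i == n then g0 else g i), (fun x y => S x y - g0 x * g0 y).
  split.
  - by move=> i; case: ifP.
  - split.
    + move=> p; apply: cvgB; first exact: cS.
      apply: cvgM.
        by apply: (@continuous_comp _ _ _ fst g0); [exact: cvg_fst|exact: cg0].
      by apply: (@continuous_comp _ _ _ snd g0); [exact: cvg_snd|exact: cg0].
    + have -> : (fun x y => S x y - g0 x * g0 y) =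
          (fun x y => S x y - S x x0 * S y x0 / S x0 x0).
        by apply/funext => x; apply/funext => y; rewrite g0E.
      exact: psd_pivot.
    + by move=> x y; rewrite symS (mulrC (g0 x)).
  - move=> x y; rewrite big_ord_recr/= eqxx KE -addrA; congr (_ + _); last by ring.
    by apply: eq_bigr => i _; rewrite ltn_eqF.
  - move=> x; rewrite inE => /orP[/eqP->|xs].
      rewrite g0E; have [->|h] := eqVneq (S x0 x0) 0; first by rewrite mul0r mul0r subr0.
      by rewrite -mulrA mulfV// mulr1 subrr.
    have Sxx := S0 x xs; have := psd_cauchy_schwarz x x0 psdS symS.
    rewrite Sxx mul0r => h.
    have -> : g0 x = 0.
      rewrite /g0; suff -> : S x x0 = 0 by rewrite mul0r.
      by apply/eqP; rewrite -sqrf_eq0 eq_le h sqr_ge0.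
    by rewrite mul0r subr0.
have [cK1 psdK symK] := cK.
have nU x : nbhs x [set y | K y y + K x x - 2 * K y x < eps].
  have cD : continuous (fun y => K y y + K x x - 2 * K y x).
    move=> y; apply: cvgB.
      by apply: cvgD; [exact: (continuous_diag cK1)|exact: cvg_cst].
    by apply: cvgM; [exact: cvg_cst|exact: (continuous_section _ x cK1)].
  have h : K x x + K x x - 2 * K x x < eps.
    by have -> : K x x + K x x - 2 * K x x = 0 by ring.
  exact: (@cvgr_lt _ _ _ _ _ _ (cD x)).
have [s hs] := compact_finite_net cV nU.
have [n [g [S [cg cS KE S0]]]] := dec s.
exists n, g, S; split=> // x.
have [y ys /= Kxy] := hs x.
have Sy0 := S0 y ys; have [_ psdS symS] := cS.
have Sxy : S x y = 0.
  have := psd_cauchy_schwarz x y psdS symS; rewrite Sy0 mulr0 => h.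
  by apply/eqP; rewrite -sqrf_eq0 eq_le h sqr_ge0.
apply: le_trans (ltW Kxy).
have -> : K x x + K y y - 2 * K x y =
    \sum_(i < n) (g i x - g i y) ^+ 2 + (S x x + S y y - 2 * S x y).
  rewrite !KE.
  have -> : \sum_(i < n) (g i x - g i y) ^+ 2 =
     \sum_(i < n) g i x * g i x + \sum_(i < n) g i y * g i y
     - 2 * \sum_(i < n) g i x * g i y.
    rewrite mulr_sumr -big_split/= -sumrB; apply: eq_bigr => i _; ring.
  ring.
rewrite Sy0 Sxy mulr0 addr0 subr0 lerDr.
by apply: sumr_ge0 => i _; exact: sqr_ge0.
Qed.

Lemma continuous_borel_measurable (f : V -> R) : continuous f -> measurable_fun setT f.
Proof.
move=> /continuousP cf; apply: (measurability _ (RGenOpens.measurableE R)).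
move=> _ [_ [a [b ->]] <-]; rewrite setTI; apply: open_borel; apply: cf.
exact: interval_open.
Qed.

Lemma continuous_L2 (f : V -> R) : continuous f -> L2 mu f.
Proof.
move=> cf; have [M fM] := compact_continuous_bounded cV cf.
by apply: L2_bounded fM; exact: continuous_borel_measurable.
Qed.

Lemma kernel_bounded K : continuous (fun p : V * V => K p.1 p.2) ->
  exists M, forall p : V * V, `|K p.1 p.2| <= M.
Proof.
move=> cK; apply: compact_continuous_bounded cK.
by rewrite -setXTT; exact: compact_setX.
Qed.

(** A function of a pair is read as a function of a tuple with two entries,
    where continuity implies measurability. *)
Lemma kernel_measurable K : continuous (fun p : V * V => K p.1 p.2) ->
  measurable_fun setT (fun p : V * V => K p.1 p.2).
Proof.
move=> cK.
pose F (t : 2.-tuple V) := K (tnth t ord0) (tnth t (lift ord0 ord0)).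
have cF : continuous F.
  move=> t; apply: (@continuous_comp _ _ _
    (fun t : 2.-tuple V => (tnth t ord0, tnth t (lift ord0 ord0))) (fun p : V * V => K p.1 p.2)).
    by apply: continuous_pair; exact: tnth_continuous.
  exact: cK.
have -> : (fun p : V * V => K p.1 p.2) = F \o (fun p => [tuple of p.1 :: [:: p.2]]).
  by apply/funext => p.
apply: measurableT_comp; first exact: continuous_tuple_measurable.
apply: measurable_cons => //.
have := @measurable_cons _ _ (V * V)%type V snd 0 (fun=> [tuple]).
apply => //; exact: measurable_cst.
Qed.

Lemma kernel_section_integ K x f : continuous (fun p : V * V => K p.1 p.2) ->
  L2 mu f -> integ mu (fun y => K x y * f y).
Proof.
move=> cK Lf; have [M KM] := kernel_bounded cK.
apply: (@integ_bounded_mul _ _ _ _ _ _ M); last exact: L2_integ.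
  rewrite (_ : K x = (fun p : V * V => K p.1 p.2) \o (pair x))//.
  by apply: measurableT_comp; [exact: kernel_measurable|exact: pair1_measurable].
by move=> y; exact: (KM (x, y)).
Qed.

Lemma kernel_op_continuous K f : continuous (fun p : V * V => K p.1 p.2) ->
  L2 mu f -> continuous (kernel_op mu K f).
Proof.
move=> cK Lf x0; apply/cvgrPdist_le => eps eps0.
have intf := integrable_norm (L2_integ Lf).
set C := \int[mu]_y `|f y|.
have C0 : 0 <= C by exact: Rintegral_ge0.
have e1 : 0 < eps / (C + 1) by rewrite divr_gt0// ltr_wpDl.
near=> x.
rewrite /kernel_op -RintegralB//; [|exact: kernel_section_integ..].
have intD : integ mu (fun y => K x0 y * f y - K x y * f y).
  by apply: integB; exact: kernel_section_integ.
apply: (le_trans (le_normr_Rintegral measurableT intD)).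
apply: (@le_trans _ _ (\int[mu]_y (eps / (C + 1) * `|f y|))).
  apply: le_Rintegral => //.
  - exact: (@integrable_norm _ _ _ mu setT (fun y => K x0 y * f y - K x y * f y)).
  - exact: integZ.
  move=> y _; rewrite -mulrBl normrM; apply: ler_wpM2r => //.
  apply: ltW; move: y; near: x.
  exact: (@tube_uniform _ _ _ cV (fun p => K p.1 p.2)).
rewrite RintegralZl// -/C mulrAC ler_pdivrMr ?ltr_wpDl//.
by apply: ler_wpM2l; [exact: ltW|rewrite lerDl].
Unshelve. all: by end_near. Qed.

Lemma L2_kernel_op K f : continuous (fun p : V * V => K p.1 p.2) ->
  L2 mu f -> L2 mu (kernel_op mu K f).
Proof. by move=> cK Lf; apply: continuous_L2; exact: kernel_op_continuous. Qed.

(** The symmetry of the kernel and Fubini's theorem. *)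
Lemma kernel_op_sym K f h : mercer_kernel K -> L2 mu f -> L2 mu h ->
  dotL2 mu (kernel_op mu K f) h = dotL2 mu f (kernel_op mu K h).
Proof.
move=> [cK _ symK] Lf Lh; have [M KM] := kernel_bounded cK.
pose F (p : V * V) := K p.1 p.2 * (h p.1 * f p.2).
have iF : integ (mu \x mu)%E F.
  apply: (@integ_prod_mul _ _ _ _ _ _ _ h f (fun p => K p.1 p.2) M) => //.
  - exact: L2_integ.
  - exact: L2_integ.
  - exact: kernel_measurable.
have i1 x : integ mu (fun y => F (x, y)).
  have -> : (fun y => F (x, y)) = (fun y => (K x y * f y) * h x).
    by apply/funext => y; rewrite /F/=; ring.
  by apply: integZr; exact: kernel_section_integ.
have i2 y : integ mu (fun x => F (x, y)).
  have -> : (fun x => F (x, y)) = (fun x => (K y x * h x) * f y).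
    by apply/funext => x; rewrite /F/= (symK x y); ring.
  by apply: integZr; exact: kernel_section_integ.
transitivity (\int[(mu \x mu)%E]_p F p).
  rewrite Rintegral_prod1//; apply: eq_Rintegral => x _.
  rewrite /kernel_op -RintegralZr//; last exact: kernel_section_integ.
  by apply: eq_Rintegral => y _; rewrite /F/=; ring.
rewrite Rintegral_prod2//; apply: eq_Rintegral => y _.
rewrite /kernel_op -RintegralZl//; last exact: kernel_section_integ.
by apply: eq_Rintegral => x _; rewrite /F/= (symK x y); ring.
Qed.

Definition quad_form K f := dotL2 mu (kernel_op mu K f) f.

Lemma quad_form_decomp K S n (g : nat -> V -> R) f :
  continuous (fun p : V * V => S p.1 p.2) -> (forall i, continuous (g i)) ->
  (forall x y, K x y = \sum_(i < n) g i x * g i y + S x y) -> L2 mu f ->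
  quad_form K f = \sum_(i < n) dotL2 mu (g i) f ^+ 2 + quad_form S f.
Proof.
move=> cS cg KE Lf.
have Lg i : L2 mu (g i) by exact: continuous_L2.
have opE : kernel_op mu K f =
    (fun x => (\sum_(i < n) dotL2 mu (g i) f * g i x) + kernel_op mu S f x).
  apply/funext => x; rewrite /kernel_op.
  have -> : (fun y => K x y * f y) =
      (fun y => \sum_(i < n) g i x * (g i y * f y) + S x y * f y).
    apply/funext => y; rewrite KE mulrDl mulr_suml; congr (_ + _).
    by apply: eq_bigr => i _; rewrite mulrA.
  have ii (i : 'I_n) : integ mu (fun y => g i x * (g i y * f y)).
    by apply: integZ; exact: L2_mul_integ.
  rewrite RintegralD//; last 2 first.
  - exact: integ_sum.
  - exact: kernel_section_integ.
  rewrite Rintegral_sum//; congr (_ + _); apply: eq_bigr => i _.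
  by rewrite RintegralZl//; [rewrite mulrC|exact: L2_mul_integ].
rewrite /quad_form opE dot_add//; last 2 first.
- by apply: L2_sum => i; exact: L2_scale.
- exact: L2_kernel_op.
congr (_ + _); rewrite dot_sum//; last by move=> i; exact: L2_scale.
by apply: eq_bigr => i _; rewrite dot_scale// expr2.
Qed.

Lemma quad_form_small S f eps : continuous (fun p : V * V => S p.1 p.2) ->
  (forall x y, `|S x y| <= eps) -> L2 mu f ->
  `|quad_form S f| <= eps * (\int[mu]_y `|f y|) ^+ 2.
Proof.
move=> cS Seps Lf.
have intf := integrable_norm (L2_integ Lf).
set C := \int[mu]_y `|f y|.
have hop x : `|kernel_op mu S f x| <= eps * C.
  apply: (le_trans (le_normr_Rintegral measurableT (kernel_section_integ x cS Lf))).
  rewrite -RintegralZl//; apply: le_Rintegral => //.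
  - exact: (@integrable_norm _ _ _ mu setT _ (kernel_section_integ x cS Lf)).
  - exact: integZ.
  by move=> y _; rewrite normrM; apply: ler_wpM2r.
have Lop := L2_kernel_op cS Lf.
apply: (le_trans (le_normr_Rintegral measurableT (L2_mul_integ Lop Lf))).
rewrite expr2 mulrA -RintegralZl//; apply: le_Rintegral => //.
- exact: (@integrable_norm _ _ _ mu setT _ (L2_mul_integ Lop Lf)).
- exact: integZ.
by move=> y _; rewrite normrM; apply: ler_wpM2r.
Qed.

(** By the Cauchy-Schwarz inequality, a bound on the diagonal bounds the whole
    kernel. *)
Lemma mercer_kernel_small S eps : mercer_kernel S -> (forall x, S x x <= eps) ->
  forall x y, `|S x y| <= eps.
Proof.
move=> [_ psdS symS] Seps x y.
have e0 : 0 <= eps by apply: le_trans (Seps x); exact: psd_diag_ge0.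
rewrite -(@ler_pXn2r _ 2)// ?nnegrE// real_normK ?num_real//.
apply: (le_trans (psd_cauchy_schwarz x y psdS symS)).
by rewrite expr2; apply: ler_pM => //; exact: psd_diag_ge0.
Qed.

(** Up to a remainder that is uniformly small, the form is a sum of squares of
    scalar products. *)
Lemma quad_form_ge0 K f : mercer_kernel K -> L2 mu f -> 0 <= quad_form K f.
Proof.
move=> cK Lf; rewrite leNgt; apply/negP => q0.
set C := \int[mu]_y `|f y|.
have C1 : 0 < C ^+ 2 + 1 by rewrite ltr_wpDl// sqr_ge0.
(* small enough that the remainder stays below half of - quad_form K f *)
have e0 : 0 < - quad_form K f / (C ^+ 2 + 1) / 2 by rewrite !divr_gt0// oppr_gt0.
have [n [g [S [cg cS KE Seps]]]] := psd_finite_rank cK e0.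
have [cS1 _ _] := cS.
have hE := quad_form_decomp cS1 cg KE Lf.
have := quad_form_small cS1 (mercer_kernel_small cS Seps) Lf; rewrite -/C => hS.
have h1 : - quad_form K f / (C ^+ 2 + 1) / 2 * C ^+ 2 <= - quad_form K f / 2.
  rewrite mulrAC ler_wpM2r// mulrAC ler_pdivrMr//.
  by rewrite ler_wpM2l ?lerDl// oppr_ge0 ltW.
have h2 : 0 <= \sum_(i < n) dotL2 mu (g i) f ^+ 2.
  by apply: sumr_ge0 => i _; exact: sqr_ge0.
have h3 : - quad_form S f <= `|quad_form S f| by rewrite -normrN ler_norm.
have h4 : - quad_form K f <= - quad_form S f by rewrite hE lerN2 lerDr.
move: (le_trans h4 (le_trans h3 (le_trans hS h1))) q0; clear; lra.
Qed.

Lemma trace_decomp K S n (g : nat -> V -> R) :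
  continuous (fun p : V * V => S p.1 p.2) -> (forall i, continuous (g i)) ->
  (forall x y, K x y = \sum_(i < n) g i x * g i y + S x y) ->
  \int[mu]_x K x x = \sum_(i < n) dotL2 mu (g i) (g i) + \int[mu]_x S x x.
Proof.
move=> cS cg KE.
have Lg i : L2 mu (g i) by exact: continuous_L2.
under eq_Rintegral => x _ do rewrite KE.
have ii (i : 'I_n) : integ mu (fun y => g i y * g i y) by exact: L2_mul_integ.
rewrite RintegralD//; last 2 first.
- exact: integ_sum.
- by apply: L2_integ; apply: continuous_L2; exact: continuous_diag.
by rewrite Rintegral_sum.
Qed.

Section trace.
Context (I : choiceType) (e : I -> V -> R).

(** Bessel's inequality bounds the finite rank part; the remainder contributes
    at most a constant, which depends on the finite list s, times its uniform
    bound. *)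
Lemma sum_quad_form_le K (s : seq I) : mercer_kernel K -> (forall i, L2 mu (e i)) ->
  (forall i j, dotL2 mu (e i) (e j) = (i == j)%:R) -> uniq s ->
  \sum_(i <- s) quad_form K (e i) <= \int[mu]_x K x x.
Proof.
move=> cK Le oe us; rewrite -subr_ge0 leNgt; apply/negP; rewrite subr_lt0 -subr_gt0 => q0.
set D := (X in 0 < X) in q0.
set C := \sum_(i <- s) (\int[mu]_y `|e i y|) ^+ 2.
have C0 : 0 <= C by apply: sumr_ge0 => i _; exact: sqr_ge0.
have e0 : 0 < D / (C + 1) / 2 by rewrite !divr_gt0// ltr_wpDl.
have [n [g [S [cg cS KE Seps]]]] := psd_finite_rank cK e0.
have [cS1 psdS _] := cS.
have h1 : \sum_(i <- s) quad_form K (e i) <=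
    \sum_(j < n) dotL2 mu (g j) (g j) + D / (C + 1) / 2 * C.
  under eq_bigr => i _ do rewrite (quad_form_decomp cS1 cg KE (Le i)).
  rewrite big_split/= exchange_big/=; apply: lerD.
    apply: ler_sum => j _; apply: bessel => //.
    exact: continuous_L2.
  rewrite /C mulr_sumr; apply: ler_sum => i _.
  apply: le_trans (quad_form_small cS1 (mercer_kernel_small cS Seps) (Le i)).
  exact: ler_norm.
have h2 := trace_decomp cS1 cg KE.
have h3 : 0 <= \int[mu]_x S x x by apply: Rintegral_ge0 => x _; exact: psd_diag_ge0.
have h4 : D / (C + 1) / 2 * C <= D / 2.
  rewrite mulrAC ler_wpM2r// mulrAC ler_pdivrMr ?ltr_wpDl//.
  by rewrite ler_wpM2l ?lerDl// ltW.
rewrite /D in h4 q0 h1; lra.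
Qed.

(** The quadratic form of the remainder is nonnegative and can be dropped, and
    Parseval's identity for the finitely many functions of the finite rank
    part gives almost the whole trace. *)
Lemma sum_quad_form_ge K (eps : R) : mercer_kernel K -> orthonormal_basis mu e -> 0 < eps ->
  exists2 s : seq I, uniq s & \int[mu]_x K x x - eps <= \sum_(i <- s) quad_form K (e i).
Proof.
move=> cK oe eps0; have [Le oee ce] := oe.
set m := fine (mu setT).
have m0 : 0 <= m by exact: fine_ge0.
have e0 : 0 < eps / (m + 1) / 2 by rewrite !divr_gt0// ltr_wpDl.
have [n [g [S [cg cS KE Seps]]]] := psd_finite_rank cK e0.
have [cS1 psdS _] := cS.
have Lg i : L2 mu (g i) by exact: continuous_L2.
have e2 : 0 < eps / 2 / n.+1%:R by rewrite !divr_gt0.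
have hj (j : nat) : exists s : seq I, uniq s /\
    dotL2 mu (g j) (g j) - eps / 2 / n.+1%:R <= \sum_(i <- s) dotL2 mu (g j) (e i) ^+ 2.
  by have [s us hs] := parseval_approx oe (Lg j) e2; exists s.
have [F hF] := choice hj.
pose s := undup (flatten [seq F j | j <- iota 0 n]).
have us : uniq s by exact: undup_uniq.
exists s => //.
have h1 : \sum_(j < n) dotL2 mu (g j) (g j) - eps / 2 <=
    \sum_(i <- s) \sum_(j < n) dotL2 mu (g j) (e i) ^+ 2.
  rewrite exchange_big/=.
  apply: (@le_trans _ _ (\sum_(j < n) (dotL2 mu (g j) (g j) - eps / 2 / n.+1%:R))).
    rewrite sumrB lerD2l lerN2 sumr_const card_ord -[leLHS]mulr_natr.
    rewrite mulrAC ler_pdivrMr// ler_wpM2l ?ler_nat// ltW// divr_gt0//.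
  apply: ler_sum => j _; have [uF hFj] := hF j; apply: (le_trans hFj).
  have sub : {subset F j <= s}.
    move=> i iF; rewrite mem_undup; apply/flattenP; exists (F j) => //.
    by apply: map_f; rewrite mem_iota/= add0n.
  rewrite [leRHS](bigID (fun i => i \in F j))/=.
  have -> : \sum_(i <- s | i \in F j) dotL2 mu (g j) (e i) ^+ 2 =
      \sum_(i <- F j) dotL2 mu (g j) (e i) ^+ 2.
    rewrite -big_filter; apply: perm_big; apply: uniq_perm => //.
      exact: filter_uniq.
    move=> i; rewrite mem_filter; case: (boolP (i \in F j)) => // /sub ->//.
  by rewrite lerDl sumr_ge0// => i _; exact: sqr_ge0.
have h2 := trace_decomp cS1 cg KE.
have h3 : \int[mu]_x S x x <= eps / 2.
  have := @Rintegral_norm_le _ _ _ mu (fun x => S x x) (eps / (m + 1) / 2).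
  rewrite -/m => /(_ _ _)/wrap[].
  - by apply: L2_integ; apply: continuous_L2; exact: continuous_diag.
  - by move=> x; exact: mercer_kernel_small.
  move=> h; apply: (le_trans (ler_norm _)); apply: (le_trans h).
  rewrite mulrAC ler_wpM2r// mulrAC ler_pdivrMr ?ltr_wpDl//.
  by rewrite ler_wpM2l ?lerDl// ltW.
have h4 : \sum_(i <- s) \sum_(j < n) dotL2 mu (g j) (e i) ^+ 2 <=
    \sum_(i <- s) quad_form K (e i).
  apply: ler_sum => i _; rewrite (quad_form_decomp cS1 cg KE (Le i)) lerDl.
  exact: quad_form_ge0.
lra.
Qed.

Lemma esum_quad_form K : mercer_kernel K -> orthonormal_basis mu e ->
  (\esum_(i in [set: I]) (quad_form K (e i))%:E = (\int[mu]_x K x x)%:E)%E.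
Proof.
move=> cK oe; have [Le oee ce] := oe.
apply/eqP; rewrite eq_le; apply/andP; split.
  apply: ge_ereal_sup => _ [A [fA _] <-].
  rewrite fsbig_finite//= sumEFin lee_fin; exact: sum_quad_form_le.
apply/lee_addgt0Pr => eps eps0.
have [s us hs] := sum_quad_form_ge cK oe eps0.
rewrite -leeBlDr//; apply: esum_ge; exists [set` s].
  by split=> //; exact: finite_seq.
by rewrite -fsbig_seq// sumEFin -EFinB lee_fin.
Qed.

End trace.

(** The operator is positive and self-adjoint, so it is its own modulus. *)
Lemma mercer_trace_class K : mercer_kernel K -> trace_class mu (kernel_op mu K).
Proof.
move=> cK; have [cK1 _ _] := cK.
split; first by move=> f; exact: L2_kernel_op.
exists (kernel_op mu K).
  split=> //.
  - by move=> f; exact: L2_kernel_op.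
  - by move=> f h; exact: kernel_op_sym.
  - by move=> f; exact: quad_form_ge0.
by move=> I e oe; rewrite (esum_quad_form cK oe) ltry.
Qed.

Lemma mercer_trace K : mercer_kernel K ->
  trace_eq mu (kernel_op mu K) (\int[mu]_x K x x).
Proof.
move=> cK I e oe a; have [Le _ _] := oe.
have a0 i : (0 <= a i)%E by rewrite lee_fin; exact: quad_form_ge0.
have -> : a^\+%E = a by apply/funext => i; rewrite funeposE max_l.
have -> : a^\-%E = cst 0%E.
  by apply/funext => i; rewrite funenegE max_r// oppe_le0.
by rewrite [X in (_ - X)%E]esum1// sube0 (esum_quad_form cK oe).
Qed.

End mercer.

(** * Integrals of continuous functions over powers of a space *)

Section real_integrals.
Context (R : realType).

Lemma Rintegral_continuous (X : topologicalType) d (T : measurableType d)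
    (nu : {finite_measure set T -> \bar R}) (B : X -> T -> R) :
  (forall x, integ nu (B x)) ->
  (forall x0 e, 0 < e -> \forall x \near x0, forall y, `|B x0 y - B x y| < e) ->
  continuous (fun x => \int[nu]_y B x y).
Proof.
move=> intB unifB x0; apply/cvgrPdist_le => eps eps0.
set m := fine (nu setT).
have m0 : 0 <= m by exact: fine_ge0.
have e1 : 0 < eps / (m + 1) by rewrite divr_gt0// ltr_wpDl.
have := unifB x0 _ e1; apply: filterS => x hx.
rewrite -RintegralB//.
apply: (le_trans (@Rintegral_norm_le _ _ _ nu _ (eps / (m + 1)) _ _)).
- exact: integB.
- by move=> y; apply: ltW; exact: hx.
rewrite -/m mulrAC ler_pdivrMr ?ltr_wpDl//.
by apply: ler_wpM2l; [exact: ltW|rewrite lerDl].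
Qed.

Lemma Rintegral_ae_ge0 d (T : measurableType d)
    (nu : {finite_measure set T -> \bar R}) (f : T -> R) : measurable_fun setT f ->
  {ae nu, forall x, 0 <= f x} -> 0 <= \int[nu]_x f x.
Proof.
move=> mf f0; suff -> : \int[nu]_x f x = \int[nu]_x `|f x|.
  by apply: Rintegral_ge0 => x _.
rewrite /Rintegral; congr fine; apply: ae_eq_integral => //.
- exact/measurable_EFinP.
- by apply/measurable_EFinP; exact: measurableT_comp.
- by apply: filterS f0 => x x0 _; rewrite ger0_norm.
Qed.

End real_integrals.

Section power_integrals.
Context (R : realType) d (V : borelType d) (cV : compact [set: V]).
Context (mu : {finite_measure set V -> \bar R}).

Lemma mpow_integ n (F : n.-tuple V -> R) : continuous F -> integ (mpow mu n) F.
Proof.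
move=> cF; have [M FM] := compact_continuous_bounded (@tuple_compact _ n cV) cF.
by apply: integ_bounded FM; exact: continuous_tuple_measurable.
Qed.

Lemma continuous_integ (F : V -> R) : continuous F -> integ mu F.
Proof. by move=> cF; apply: L2_integ; exact: continuous_L2. Qed.

Lemma Rintegral_mpow_continuous (X : topologicalType) n (B : X -> n.-tuple V -> R) :
  continuous (fun p : X * n.-tuple V => B p.1 p.2) ->
  continuous (fun x => \int[mpow mu n]_w B x w).
Proof.
move=> cB; apply: Rintegral_continuous.
  move=> x; apply: mpow_integ => w.
  apply: (@continuous_comp _ _ _ (fun w => (x, w)) (fun p : X * n.-tuple V => B p.1 p.2)).
    by apply: continuous_pair; [exact: cst_continuous|move=> z; exact: cvg_id].
  exact: cB.
move=> x0 e e0.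
exact: (@tube_uniform _ _ _ (@tuple_compact _ n cV) (fun p : X * n.-tuple V => B p.1 p.2)).
Qed.

(** Both orders of integration are recorded: the first coordinate is
    integrated first or last. *)
Lemma Rintegral_mpow_cons n (F : n.+1.-tuple V -> R) : continuous F ->
  \int[mpow mu n.+1]_u F u = \int[mpow mu n]_q \int[mu]_x F [tuple of x :: q] /\
  \int[mpow mu n.+1]_u F u = \int[mu]_x \int[mpow mu n]_q F [tuple of x :: q].
Proof.
move=> cF; have iF := mpow_integ cF.
have h A : measurable A -> (mu \x mpow mu n)%E (@cons_pair _ V n @^-1` A) = mpow mu n.+1 A by [].
have E := Rintegral_pushforward (@measurable_cons_pair _ V n) h iF.
have iF' := integ_pullback (@measurable_cons_pair _ V n) h iF.
split; rewrite E.
- rewrite (Rintegral_prod2 iF')// => q; apply: continuous_integ.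
  move=> x; apply: (@continuous_comp _ _ _ (fun x => [tuple of x :: q]) F); last exact: cF.
  by apply: tuple_cons_continuous => z; [exact: cvg_id|exact: cvg_cst].
- rewrite (Rintegral_prod1 iF')// => x; apply: mpow_integ.
  move=> q; apply: (@continuous_comp _ _ _ (fun q : n.-tuple V => [tuple of x :: q]) F); last exact: cF.
  by apply: tuple_cons_continuous; [exact: cst_continuous|move=> z; exact: cvg_id].
Qed.

Lemma Rintegral_mpow_cat n m (F : (n + m).-tuple V -> R) : continuous F ->
  \int[mpow mu (n + m)]_u F u =
  \int[mpow mu n]_v \int[mpow mu m]_w F [tuple of v ++ w].
Proof.
move=> cF; have iF := mpow_integ cF.
have h A : measurable A -> (mpow mu n \x mpow mu m)%E
  ((fun p : n.-tuple V * m.-tuple V => [tuple of p.1 ++ p.2]) @^-1` A) = mpow mu (n + m) A.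
  exact: mpow_cat.
have E := Rintegral_pushforward (@measurable_cat _ V n m) h iF.
have iF' := integ_pullback (@measurable_cat _ V n m) h iF.
rewrite E (Rintegral_prod1 iF')// => v; apply: mpow_integ.
move=> w; apply: (@continuous_comp _ _ _ (fun w : m.-tuple V => [tuple of v ++ w]) F); last exact: cF.
by apply: tuple_cat_continuous; [exact: cst_continuous|move=> z; exact: cvg_id].
Qed.

Lemma Rintegral_mpow0 (F : 0.-tuple V -> R) : \int[mpow mu 0]_u F u = F [tuple].
Proof.
have -> : F = cst (F [tuple]) by apply/funext => u; rewrite (tuple0 u).
by rewrite Rintegral_cst// mpow_setT expr0 mulr1.
Qed.

End power_integrals.

(** * Pseudo-moments and the growth of their integrals *)

Definition opt_seq (V : Type) (o : option V) : seq V := if o is Some x then [:: x] else [::].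

(** The part of the definition of the block moment hierarchy that does not
    mention the hypergraph, for functions of lists that depend only on their
    sets of entries. In [pm_psd] the two options stand for the subsets with at
    most one element. *)
Record pseudo_moments (R : realType) d (V : borelType d) (N : nat) (P : seq V -> R) : Prop := {
  pm_eq : forall s t, s =i t -> P s = P t;
  pm_cont : forall n, (n <= N)%N -> continuous (fun u : n.-tuple V => P u);
  pm_psd : forall q, (size q + 2 <= N)%N ->
    psd_kernel (fun a b : option V => P (q ++ opt_seq a ++ opt_seq b));
  pm_nil : P [::] = 1 }.

Section moments.
Context (R : realType) d (V : borelType d) (cV : compact [set: V]).
Context (mu : {finite_measure set V -> \bar R}).
Context (N : nat) (P : seq V -> R).
Context (pmP : pseudo_moments N P).

Let P_eq := pm_eq pmP.
Let P_cont := pm_cont pmP.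
Let P_psd := pm_psd pmP.

Lemma pm_comp_continuous (X : topologicalType) n (f : X -> n.-tuple V) : (n <= N)%N ->
  continuous f -> continuous (fun x => P (f x)).
Proof.
move=> nN cf x; apply: (@continuous_comp _ _ _ f (fun u : n.-tuple V => P u)).
  exact: cf.
exact: P_cont.
Qed.

Lemma pm_section_continuous q : (size q + 1 <= N)%N -> continuous (fun x => P (x :: q)).
Proof.
rewrite addn1 => qN; have := @pm_comp_continuous V _ (fun x => [tuple of x :: in_tuple q]) qN.
by apply; apply: tuple_cons_continuous => z; [exact: cvg_id|exact: cvg_cst].
Qed.

Lemma pm_kernel_continuous q : (size q + 2 <= N)%N ->
  continuous (fun p : V * V => P (p.1 :: p.2 :: q)).
Proof.
rewrite addn2 => qN.
have := @pm_comp_continuous (V * V)%type _ (fun p => [tuple of p.1 :: [tuple of p.2 :: in_tuple q]]) qN.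
apply; apply: tuple_cons_continuous; first by move=> z; exact: cvg_fst.
by apply: tuple_cons_continuous => z; [exact: cvg_snd|exact: cvg_cst].
Qed.

Lemma pm_kernel q : (size q + 2 <= N)%N -> mercer_kernel (fun x y => P (x :: y :: q)).
Proof.
move=> qN; split.
- exact: pm_kernel_continuous.
- have := psd_comp (@Some V) (P_psd qN).
  congr (psd_kernel _); apply/funext => x; apply/funext => y; apply: P_eq => z.
  by rewrite mem_cat /= !inE orbC -orbA.
- by move=> x y; apply: P_eq => z; rewrite !inE orbCA.
Qed.

(** The kernel is that of [psd_option_shift] for the matrices of [pm_psd]. Its
    integral compares three consecutive moments. *)
Lemma pm_shifted_kernel q t : (size q + 2 <= N)%N ->
  mercer_kernel (fun x y => P (x :: y :: q) + t * (P (x :: q) + P (y :: q)) + t ^+ 2 * P q).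
Proof.
move=> qN; have qN1 : (size q + 1 <= N)%N by apply: leq_trans qN; rewrite leq_add2l.
split.
- move=> p; apply: cvgD; last exact: cvg_cst.
  apply: cvgD; first exact: pm_kernel_continuous.
  apply: cvgM; first exact: cvg_cst.
  apply: cvgD.
    apply: (@continuous_comp _ _ _ fst (fun x => P (x :: q))); first exact: cvg_fst.
    exact: pm_section_continuous.
  apply: (@continuous_comp _ _ _ snd (fun x => P (x :: q))); first exact: cvg_snd.
  exact: pm_section_continuous.
- have := psd_option_shift t (P_psd qN); rewrite /= => /(_ _)/wrap[].
    by move=> a b; apply: P_eq => z; rewrite !mem_cat; congr (_ || _); rewrite orbC.
  congr (psd_kernel _); apply/funext => x; apply/funext => y.
  congr (_ + _ * (_ + _) + _ * _); apply: P_eq => z; rewrite ?cats0 ?cat0s// !inE ?mem_cat ?inE.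
  + by rewrite orbC -orbA.
  + by rewrite orbC.
  + by rewrite orbC.
- by move=> x y; congr (_ + _ * _ + _); [apply: P_eq => z; rewrite !inE orbCA|rewrite addrC].
Qed.

(** P s is a diagonal entry of the kernel attached to the tail of s, since
    repeated entries of a list do not count. *)
Lemma pm_ge0 s : (size s < N)%N -> (0 < size s)%N -> 0 <= P s.
Proof.
case: s => [//|x q] /= qN _.
have qN2 : (size q + 2 <= N)%N by rewrite addn2.
have [_ psdP _] := pm_kernel qN2.
have := psd_diag_ge0 x psdP; congr (_ <= _); apply: P_eq => z.
by rewrite !inE orbA orbb.
Qed.

Definition moment j := \int[mpow mu j]_u P u.

Lemma moment0 : moment 0 = 1.
Proof.
rewrite /moment Rintegral_mpow0.
by apply: etrans (pm_nil pmP); apply: P_eq.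
Qed.

Lemma moment1 : (0 < N)%N -> moment 1 = \int[mu]_x P [:: x].
Proof.
move=> N0; rewrite /moment (Rintegral_mpow_cons cV mu (P_cont N0)).2.
by apply: eq_Rintegral => x _; rewrite Rintegral_mpow0.
Qed.

(** Integrate the kernel of [pm_shifted_kernel] over both of its variables and
    over q. As a polynomial in t mu(V) it is the quadratic form of the Hankel
    matrix of m j, m (j+1), m (j+2). *)
Lemma moment_shift_ge0 j t : (j + 2 <= N)%N ->
  0 <= moment j.+2 + 2 * t * fine (mu setT) * moment j.+1
       + t ^+ 2 * fine (mu setT) ^+ 2 * moment j.
Proof.
move=> jN; set m := fine (mu setT).
have jN1 : (j.+1 <= N)%N by apply: leq_trans jN; rewrite addn2.
have jN0 : (j <= N)%N by apply: leq_trans jN1.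
have jN2 : (j.+2 <= N)%N by rewrite -addn2.
pose Z (q : j.-tuple V) := \int[mu]_x \int[mu]_y
  (P (x :: y :: q) + t * (P (x :: q) + P (y :: q)) + t ^+ 2 * P q).
have Z0 q : 0 <= Z q.
  have qN : (size q + 2 <= N)%N by rewrite size_tuple.
  have L1 : L2 mu (cst 1) by apply: continuous_L2 => // x; exact: cvg_cst.
  have := quad_form_ge0 cV (pm_shifted_kernel t qN) L1; congr (_ <= _).
  rewrite /quad_form /dotL2 /kernel_op /Z; apply: eq_Rintegral => x _.
  by rewrite mulr1; apply: eq_Rintegral => y _; rewrite mulr1.
pose W2 (q : j.-tuple V) := \int[mu]_x \int[mu]_y P (x :: y :: q).
pose W1 (q : j.-tuple V) := \int[mu]_x P (x :: q).
have i1 (q : j.-tuple V) : integ mu (fun x => P (x :: q)).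
  by apply: continuous_integ => //; apply: pm_section_continuous; rewrite size_tuple addn1.
have ZE q : Z q = W2 q + 2 * t * m * W1 q + t ^+ 2 * m ^+ 2 * P q.
  have qN : (size q + 2 <= N)%N by rewrite size_tuple.
  have [cK _ _] := pm_kernel qN.
  have L1 : L2 mu (cst 1) by apply: continuous_L2 => // x; exact: cvg_cst.
  have ik x : integ mu (fun y => P (x :: y :: q)).
    have -> : (fun y => P (x :: y :: q)) = (fun y => P (x :: y :: q) * cst 1 y).
      by apply/funext => y; rewrite mulr1.
    exact: (@kernel_section_integ _ _ _ cV mu (fun x y => P (x :: y :: q))).
  have ik2 : integ mu (fun x => \int[mu]_y P (x :: y :: q)).
    have -> : (fun x => \int[mu]_y P (x :: y :: q)) =
        kernel_op mu (fun x y => P (x :: y :: q)) (cst 1).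
      by apply/funext => x; apply: eq_Rintegral => y _; rewrite mulr1.
    by apply: L2_integ; exact: L2_kernel_op.
  have inner x : \int[mu]_y (P (x :: y :: q) + t * (P (x :: q) + P (y :: q)) + t ^+ 2 * P q)
      = \int[mu]_y P (x :: y :: q) + (t * m * P (x :: q) + (t * W1 q + t ^+ 2 * m * P q)).
    have ic c : integ mu (fun _ => c : R) by exact: finite_measure_integrable_cst.
    have is_ : integ mu (fun y => t * (P (x :: q) + P (y :: q))).
      by apply: integZ; apply: integD.
    rewrite RintegralD//; last by apply: integD.
    rewrite RintegralD// RintegralZl//; last by apply: integD.
    rewrite RintegralD// !Rintegral_cst// -/m -/(W1 q); ring.
  have ic c : integ mu (fun _ => c : R) by exact: finite_measure_integrable_cst.
  rewrite /Z; under eq_Rintegral => x _ do rewrite inner.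
  rewrite RintegralD//; last by apply: integD => //; exact: integZ.
  rewrite RintegralD//; last exact: integZ.
  rewrite RintegralZl// Rintegral_cst// -/m -/(W1 q) -/(W2 q); ring.
have : 0 <= \int[mpow mu j]_q Z q by exact: Rintegral_ge0.
congr (_ <= _); under eq_Rintegral => q _ do rewrite ZE.
have cW1 : continuous (fun q : j.+1.-tuple V => \int[mu]_x P (x :: q)).
  apply: Rintegral_continuous.
    move=> q; apply: continuous_integ => //; apply: pm_section_continuous.
    by rewrite size_tuple addn1.
  move=> q e e0.
  apply: (@tube_uniform _ _ _ cV (fun p : j.+1.-tuple V * V => P (p.2 :: p.1))) => //.
  apply: (@pm_comp_continuous _ _ (fun p : j.+1.-tuple V * V => [tuple of p.2 :: p.1])) => //.
  by apply: tuple_cons_continuous => z; [exact: cvg_snd|exact: cvg_fst].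
have cW1' : continuous W1.
  apply: Rintegral_continuous => // q e e0.
  apply: (@tube_uniform _ _ _ cV (fun p : j.-tuple V * V => P (p.2 :: p.1))) => //.
  apply: (@pm_comp_continuous _ _ (fun p : j.-tuple V * V => [tuple of p.2 :: p.1])) => //.
  by apply: tuple_cons_continuous => z; [exact: cvg_snd|exact: cvg_fst].
have iW1 : integ (mpow mu j) W1 by exact: mpow_integ.
have iP : integ (mpow mu j) (fun u => P u) by apply: mpow_integ => //; exact: P_cont.
have W2E q : W2 q = \int[mu]_y \int[mu]_x P (x :: y :: q).
  rewrite /W2; apply: eq_Rintegral => x _; apply: eq_Rintegral => y _.
  by apply: P_eq => z; rewrite !inE orbCA.
have iW2 : integ (mpow mu j) W2.
  apply: mpow_integ => //.
  have -> : W2 = (fun q => \int[mu]_y \int[mu]_x P (x :: y :: q)).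
    by apply/funext.
  apply: Rintegral_continuous.
    move=> q; apply: continuous_integ => // y.
    apply: (@continuous_comp _ _ _ (fun y => [tuple of y :: q])
      (fun q : j.+1.-tuple V => \int[mu]_x P (x :: q))); last exact: cW1.
    by apply: tuple_cons_continuous => z; [exact: cvg_id|exact: cvg_cst].
  move=> q e e0.
  apply: (@tube_uniform _ _ _ cV (fun p : j.-tuple V * V => \int[mu]_x P (x :: p.2 :: p.1))) => //.
  move=> p; apply: (@continuous_comp _ _ _ (fun p : j.-tuple V * V => [tuple of p.2 :: p.1])
      (fun q : j.+1.-tuple V => \int[mu]_x P (x :: q))); last exact: cW1.
  by apply: tuple_cons_continuous => z; [exact: cvg_snd|exact: cvg_fst].
rewrite RintegralD//; last 2 first.
- by apply: integD => //; exact: integZ.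
- exact: integZ.
rewrite RintegralD//; last exact: integZ.
rewrite !RintegralZl//; congr (_ + _ * _ + _ * _).
- rewrite /moment (Rintegral_mpow_cons cV mu (P_cont jN2)).1.
  rewrite (Rintegral_mpow_cons cV mu cW1).1.
  by apply: eq_Rintegral => q _; rewrite W2E.
- by rewrite /moment (Rintegral_mpow_cons cV mu (P_cont jN1)).1.
Qed.

(** With t = - m 1 / mu(V), the previous inequality says that the differences
    d_j = m (j+1) - (m 1) (m j) satisfy d_(j+1) >= (m 1) d_j, and d_0 = 0. *)
Lemma moment_step j : (j < N)%N -> 0 < moment 1 -> moment 1 * moment j <= moment j.+1.
Proof.
move=> jN m1; rewrite -subr_ge0.
have mu0 : 0 < fine (mu setT).
  rewrite lt_def fine_ge0// andbT; apply/eqP => mu0.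
  have N0 : (0 < N)%N by apply: leq_ltn_trans jN.
  have c1 : continuous (fun x => P [:: x]) by exact: pm_section_continuous.
  have [M PM] := compact_continuous_bounded cV c1.
  have := Rintegral_norm_le (continuous_integ cV mu c1) PM.
  by rewrite mu0 mulr0 -moment1// normr_le0 => /eqP m10; rewrite m10 ltxx in m1.
elim: j jN => [|j IH] jN; first by rewrite moment0 mulr1 subrr.
have := @moment_shift_ge0 j (- moment 1 / fine (mu setT)).
rewrite addn2 => /(_ jN).
have -> : 2 * (- moment 1 / fine (mu setT)) * fine (mu setT) = - 2 * moment 1.
  by field; rewrite gt_eqF.
have -> : (- moment 1 / fine (mu setT)) ^+ 2 * fine (mu setT) ^+ 2 = moment 1 ^+ 2.
  by field; rewrite gt_eqF.
have := mulr_ge0 (ltW m1) (IH (ltnW jN)); lra.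
Qed.

Lemma moment_gt0 j : (j <= N)%N -> 0 < moment 1 -> 0 < moment j.
Proof.
move=> jN m1; elim: j jN => [|j IH] jN; first by rewrite moment0.
by apply: lt_le_trans (moment_step jN m1); rewrite mulr_gt0// IH// ltnW.
Qed.

Lemma moment_pow i j : (j + i <= N)%N -> 0 < moment 1 ->
  moment 1 ^+ i * moment j <= moment (j + i).
Proof.
move=> jN m1; elim: i jN => [|i IH] jN; first by rewrite mul1r addn0.
rewrite addnS in jN *; apply: le_trans (moment_step jN m1).
by rewrite exprS -mulrA ler_pM2l// IH// ltnW.
Qed.

End moments.

(** * The feasible kernel of the theta programs *)

Lemma mem_permute_tuple (T : eqType) n (s : 'S_n) (t : n.-tuple T) :
  permute_tuple s t =i t.
Proof.
move=> z; apply/tnthP/tnthP => -[i ->].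
  by exists (s i); rewrite tnth_mktuple.
by exists ((s^-1)%g i); rewrite tnth_mktuple permKV.
Qed.

Lemma cons2_tupleE d (V : borelType d) k (x y : V) (v : k.-tuple V) :
  cons2_tuple (k := k.+2) x y v = [tuple of x :: [tuple of y :: v]].
Proof.
apply: eq_from_tnth => i; rewrite tnth_mktuple.
by rewrite (tnth_nth x).
Qed.

Section dual_function.
Context (R : realType) d (V : borelType d) (cV : compact [set: V]).
Context (mu : {finite_measure set V -> \bar R}).
Context (k r : nat) (P : seq V -> R).
Local Notation K := k.+2.
Local Notation N := (K + r + 1)%N.
Context (pmP : pseudo_moments N P).

Let P_eq := pm_eq pmP.
Let P_cont := pm_cont pmP.

Definition extend_avg (v : seq V) : R := \int[mpow mu r]_w P (v ++ w).

Definition dual_fun (c : R) (v : K.-tuple V) : R := c * extend_avg v.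

Lemma pm_cat_continuous n : (n <= K.+1)%N ->
  continuous (fun p : n.-tuple V * r.-tuple V => P (p.1 ++ p.2)).
Proof.
move=> nK.
have h : (n + r <= N)%N by rewrite -addnA [X in (_ <= _ + X)%N]addnC addnA addn1 leq_add2r.
apply: (@pm_comp_continuous _ _ _ _ _ pmP _ _ (fun p : n.-tuple V * r.-tuple V => [tuple of p.1 ++ p.2]) h).
exact: cat_continuous.
Qed.

Lemma pm_cat_section_continuous (v : seq V) : (size v <= K.+1)%N ->
  continuous (fun w : r.-tuple V => P (v ++ w)).
Proof.
move=> vK; have h : (size v + r <= N)%N.
  by rewrite -addnA [X in (_ <= _ + X)%N]addnC addnA addn1 leq_add2r.
apply: (@pm_comp_continuous _ _ _ _ _ pmP _ _ (fun w : r.-tuple V => [tuple of in_tuple v ++ w]) h).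
by apply: tuple_cat_continuous; [exact: cst_continuous|move=> z; exact: cvg_id].
Qed.

Lemma extend_avg_continuous n : (n <= K.+1)%N ->
  continuous (fun v : n.-tuple V => extend_avg v).
Proof.
move=> nK.
apply: (@Rintegral_mpow_continuous _ _ _ cV mu _ _ (fun (v : n.-tuple V) (w : r.-tuple V) => P (v ++ w))).
exact: pm_cat_continuous.
Qed.

Lemma extend_avg_eq s t : s =i t -> extend_avg s = extend_avg t.
Proof.
move=> st; apply: eq_Rintegral => w _; apply: P_eq => z.
by rewrite !mem_cat st.
Qed.

Lemma dual_fun_continuous c : continuous (dual_fun c).
Proof.
move=> v; apply: (@continuous_comp _ _ _ (fun v : K.-tuple V => extend_avg v) ( *%R c)).
  exact: (@extend_avg_continuous K).
exact: mulrl_continuous.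
Qed.

Lemma dual_fun_L2sym c : L2sym mu K (dual_fun c).
Proof.
split; last first.
  by move=> s t; rewrite /dual_fun (extend_avg_eq (mem_permute_tuple s t)).
have [M AM] := compact_continuous_bounded (@tuple_compact _ K cV) (@dual_fun_continuous c).
apply: L2_bounded AM; apply: continuous_tuple_measurable => //.
exact: dual_fun_continuous.
Qed.

(** The scalar product with F is the integral over V^(k+r) of P u times F at
    the first k coordinates of u. As P and the measure are invariant under
    permutations, F can be replaced by its symmetrization, which is
    nonnegative almost everywhere. *)
Lemma dual_fun_polya_ge0 c F : 0 <= c -> polya_cone mu K r F ->
  0 <= dotL2 (mpow mu K) (dual_fun c) F.
Proof.
move=> c0 [[LF symF] aeF].
pose hd (u : (K + r).-tuple V) := [tuple tnth u (lshift r i) | i < K].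
pose G (u : (K + r).-tuple V) := P u * F (hd u).
pose cat (p : K.-tuple V * r.-tuple V) := [tuple of p.1 ++ p.2].
have cP : continuous (fun u : (K + r).-tuple V => P u).
  by apply: P_cont; rewrite addn1.
have mP : measurable_fun setT (fun u : (K + r).-tuple V => P u).
  exact: continuous_tuple_measurable.
have mF := L2_measurable LF.
have mG : measurable_fun setT G.
  apply: measurable_funM => //; apply: measurableT_comp => //.
  exact: measurable_reindex.
have Gcat p : G (cat p) = P (p.1 ++ p.2) * F p.1.
  rewrite /G; congr (_ * F _).
  by apply: eq_from_tnth => i; rewrite tnth_mktuple tnth_lshift.
have [M PM] := compact_continuous_bounded (@tuple_compact _ (K + r) cV) cP.
have iGcat : integ (mpow mu K \x mpow mu r)%E (G \o cat).
  have := @integ_prod_mul _ _ _ _ _ (mpow mu K) (mpow mu r) F (cst 1)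
    (fun p => P (cat p)) M (L2_integ LF).
  move=> /(_ _ _ _)/wrap[].
  - exact: finite_measure_integrable_cst.
  - exact: (measurableT_comp mP (@measurable_cat _ V K r)).
  - by move=> p; exact: PM.
  by under eq_fun => p do rewrite mulr1 -Gcat.
have hcat A : measurable A -> (mpow mu K \x mpow mu r)%E (cat @^-1` A) = mpow mu (K + r) A.
  exact: mpow_cat.
have mcat : measurable_fun setT cat := @measurable_cat _ V K r.
have iG : integ (mpow mu (K + r)) G by exact: (integ_pushforward mcat hcat).
have islice v : integ (mpow mu r) (fun w => (G \o cat) (v, w)).
  have -> : (fun w => (G \o cat) (v, w)) = (fun w : r.-tuple V => P (v ++ w) * F v).
    by apply/funext => w; rewrite /= Gcat.
  apply: integZr; apply: mpow_integ => //.
  by apply: pm_cat_section_continuous; rewrite size_tuple.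
have -> : dotL2 (mpow mu K) (dual_fun c) F = c * \int[mpow mu (K + r)]_u G u.
  rewrite (Rintegral_pushforward mcat hcat iG) (Rintegral_prod1 iGcat islice).
  rewrite -RintegralZl//; last exact: (integ_prod1 iGcat islice).
  apply: eq_Rintegral => v _; rewrite /dual_fun -mulrA; congr (_ * _).
  rewrite /extend_avg -RintegralZr//.
    by apply: eq_Rintegral => w _; rewrite /= Gcat.
  apply: mpow_integ => //.
  by apply: pm_cat_section_continuous; rewrite size_tuple.
apply: mulr_ge0 => //.
pose Gs (s : 'S_(K + r)) (u : (K + r).-tuple V) := P u * F [tuple tnth u (s (lshift r i)) | i < K].
have GsE s : Gs s = G \o permute_tuple s.
  apply/funext => u; rewrite /Gs /G /=; congr (_ * F _).
    by apply: P_eq => z; rewrite mem_permute_tuple.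
  by apply: eq_from_tnth => i; rewrite !tnth_mktuple.
have mperm s : measurable_fun setT (@permute_tuple V (K + r) s) by exact: measurable_reindex.
have hperm s A : measurable A -> mpow mu (K + r) (permute_tuple s @^-1` A) = mpow mu (K + r) A.
  exact: mpow_permute.
have iGs s : integ (mpow mu (K + r)) (Gs s).
  by rewrite GsE; exact: (integ_pullback (mperm s) (hperm s)).
have IGs s : \int[mpow mu (K + r)]_u Gs s u = \int[mpow mu (K + r)]_u G u.
  by rewrite (Rintegral_pushforward (mperm s) (hperm s) iG) GsE.
have symE (u : (K + r).-tuple V) : P u * symmetrize F u = ((K + r)`!%:R)^-1 * \sum_(s : 'S_(K + r)) Gs s u.
  by rewrite /symmetrize mulrCA mulr_sumr.
have -> : \int[mpow mu (K + r)]_u G u = \int[mpow mu (K + r)]_u (P u * symmetrize F u).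
  under [RHS]eq_Rintegral => u _ do rewrite symE.
  rewrite RintegralZl//; last exact: integ_sum.
  rewrite Rintegral_sum// (eq_bigr (fun=> \int[mpow mu (K + r)]_u G u)); last by move=> s _; exact: IGs.
  have nf : (K + r)`!%:R != 0 :> R by rewrite pnatr_eq0 -lt0n fact_gt0.
  rewrite sumr_const card_Sn.
  by rewrite -[X in _ * X]mulr_natl mulKf.
apply: Rintegral_ae_ge0.
  rewrite (_ : (fun u : _ => _) = (fun u => ((K + r)`!%:R)^-1 * \sum_(s : 'S_(K + r)) Gs s u)).
    by apply: integ_measurable; apply: integZ; exact: integ_sum.
  by apply/funext.
apply: filterS aeF => u Fu; apply: mulr_ge0 => //.
by apply: (pm_ge0 pmP); rewrite size_tuple// addn1.
Qed.

Lemma dual_fun_polya_dual c : 0 <= c -> polya_dual_c mu K r (dual_fun c).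
Proof.
move=> c0; split; last exact: dual_fun_continuous.
split; first exact: dual_fun_L2sym.
by move=> F; exact: dual_fun_polya_ge0.
Qed.

Lemma extend_avg_cons2 x y (v : k.-tuple V) :
  extend_avg (cons2_tuple (k := K) x y v) = \int[mpow mu r]_w P (x :: y :: (v ++ w)).
Proof. by rewrite cons2_tupleE. Qed.

Lemma cons2_continuous : continuous (fun p : (V * V) * k.-tuple V =>
  cons2_tuple (k := K) p.1.1 p.1.2 p.2).
Proof.
under eq_fun => p do rewrite cons2_tupleE.
apply: tuple_cons_continuous.
  by move=> p; apply: (@continuous_comp _ _ _ fst fst); exact: cvg_fst.
apply: tuple_cons_continuous; last by move=> p; exact: cvg_snd.
by move=> p; apply: (@continuous_comp _ _ _ fst snd); [exact: cvg_fst|exact: cvg_snd].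
Qed.

Lemma dual_fun_cons2_continuous c : continuous (fun p : (V * V) * k.-tuple V =>
  dual_fun c (cons2_tuple (k := K) p.1.1 p.1.2 p.2)).
Proof.
move=> p; apply: (@continuous_comp _ _ _ (fun p : (V * V) * k.-tuple V =>
  cons2_tuple (k := K) p.1.1 p.1.2 p.2) (dual_fun c)).
  exact: cons2_continuous.
exact: dual_fun_continuous.
Qed.

(** An average of the kernels P (x, y, v, w) over w. *)
Lemma dual_fun_slice c (v : k.-tuple V) : 0 <= c ->
  mercer_kernel (fun x y => dual_fun c (cons2_tuple (k := K) x y v)).
Proof.
move=> c0; split.
- move=> p; apply: (@continuous_comp _ _ _ (fun p : V * V => (p, v))
    (fun p => dual_fun c (cons2_tuple (k := K) p.1.1 p.1.2 p.2))).
    by apply: continuous_pair; [move=> z; exact: cvg_id|exact: cst_continuous].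
  exact: dual_fun_cons2_continuous.
- apply: psd_scale => //.
  under [X in psd_kernel X]eq_fun => x do under eq_fun => y do rewrite extend_avg_cons2.
  have sz (w : r.-tuple V) : (size (v ++ w) + 2 <= N)%N.
    by rewrite size_cat !size_tuple !addSn addn1 addn2.
  apply: (@psd_Rintegral _ _ _ (mpow mu r) _ (fun w x y => P (x :: y :: (v ++ w)))).
    by move=> w; have [] := pm_kernel pmP (sz w).
  move=> x y; apply: mpow_integ => //.
  by apply: (@pm_cat_section_continuous (x :: y :: v)); rewrite /= size_tuple.
- move=> x y; congr (_ * _); apply: extend_avg_eq => z.
  by rewrite !cons2_tupleE !inE orbCA.
Qed.

Lemma dual_fun_slice_positive c : 0 <= c -> slice_positive mu (dual_fun c).
Proof.
move=> c0 G f LG G0 Lf; apply: Rintegral_ge0 => v _.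
have cK := dual_fun_slice v c0; have [cK1 _ _] := cK.
have -> : \int[mu]_x \int[mu]_y
    (dual_fun c (cons2_tuple x y v) * G v * f x * f y) =
    G v * quad_form mu (fun x y => dual_fun c (cons2_tuple (k := K) x y v)) f.
  rewrite /quad_form /dotL2 -RintegralZl//; last first.
    by apply: L2_mul_integ => //; exact: L2_kernel_op.
  apply: eq_Rintegral => x _; rewrite mulrCA -RintegralZr//; last first.
    exact: (@kernel_section_integ _ _ _ cV mu (fun x y => dual_fun c (cons2_tuple (k := K) x y v))).
  by apply: eq_Rintegral => y _; ring.
by apply: mulr_ge0 => //; exact: quad_form_ge0.
Qed.

Lemma slice_average_kernel c : 0 <= c -> mercer_kernel (slice_average mu (dual_fun c)).
Proof.
move=> c0; split.
- apply: (@Rintegral_mpow_continuous _ _ _ cV mu _ _ (fun (p : V * V) (v : k.-tuple V) =>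
    dual_fun c (cons2_tuple (k := K) p.1 p.2 v))).
  exact: dual_fun_cons2_continuous.
- apply: psd_Rintegral.
    by move=> v; have [] := dual_fun_slice v c0.
  move=> x y; apply: mpow_integ => // v.
  apply: (@continuous_comp _ _ _ (fun v : k.-tuple V => ((x, y), v))
    (fun p => dual_fun c (cons2_tuple (k := K) p.1.1 p.1.2 p.2))).
    by apply: continuous_pair; [exact: cst_continuous|move=> z; exact: cvg_id].
  exact: dual_fun_cons2_continuous.
- move=> x y; apply: eq_Rintegral => v _.
  by have [_ _] := dual_fun_slice v c0; apply.
Qed.

Local Notation m := (moment mu P).

(** On the diagonal the two first entries coincide and count once, so only k +
    r + 1 variables remain. *)
Lemma dual_fun_trace c : \int[mu]_x slice_average mu (dual_fun c) x x = c * m (k + r).+1.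
Proof.
have kr1 : ((k + r).+1 <= N)%N by rewrite !addSn addn1 ltnS leqW.
rewrite /moment (Rintegral_mpow_cons cV mu (P_cont kr1)).2.
have cin x : continuous (fun q : (k + r).-tuple V => P (x :: q)).
  apply: (@pm_comp_continuous _ _ _ _ _ pmP _ _ (fun q : (k + r).-tuple V => [tuple of x :: q]) kr1).
  by apply: tuple_cons_continuous; [exact: cst_continuous|move=> z; exact: cvg_id].
have csl x : continuous (fun v : k.-tuple V => extend_avg (x :: v)).
  move=> v; apply: (@continuous_comp _ _ _ (fun v : k.-tuple V => [tuple of x :: v])
    (fun v : k.+1.-tuple V => extend_avg v)).
    by apply: tuple_cons_continuous; [exact: cst_continuous|move=> z; exact: cvg_id].
  by apply: extend_avg_continuous; rewrite leqW.
have E x : slice_average mu (dual_fun c) x x = c * \int[mpow mu (k + r)]_q P (x :: q).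
  rewrite (Rintegral_mpow_cat cV mu (cin x)) -RintegralZl//; last exact: mpow_integ (csl x).
  apply: eq_Rintegral => v _; congr (_ * _).
  apply: eq_Rintegral => w _; apply: P_eq => z.
  by rewrite cons2_tupleE /= !inE orbA orbb.
under eq_Rintegral => x _ do rewrite E.
rewrite RintegralZl//; apply: continuous_integ => //.
apply: Rintegral_mpow_continuous => //.
apply: (@pm_comp_continuous _ _ _ _ _ pmP _ _ (fun p : V * (k + r).-tuple V => [tuple of p.1 :: p.2]) kr1).
exact: cons_pair_continuous.
Qed.

Lemma dual_fun_total c : \int[mpow mu K]_v dual_fun c v = c * m (K + r).
Proof.
have Kr : (K + r <= N)%N by rewrite addn1.
rewrite /moment (Rintegral_mpow_cat cV mu (P_cont Kr)) -RintegralZl//.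
by apply: mpow_integ => //; exact: (@extend_avg_continuous K).
Qed.

(** The equal entries of a constant tuple count once. *)
Lemma dual_fun_diag c : \int[mu]_x dual_fun c (nseq_tuple K x) = c * m r.+1.
Proof.
have r1 : (r.+1 <= N)%N by rewrite addn1 ltnS leq_addl.
rewrite /moment (Rintegral_mpow_cons cV mu (P_cont r1)).2.
have E x : dual_fun c (nseq_tuple K x) = c * \int[mpow mu r]_q P (x :: q).
  congr (_ * _); apply: eq_Rintegral => w _; apply: P_eq => z.
  by rewrite mem_cat mem_nseq !inE.
under eq_Rintegral => x _ do rewrite E.
rewrite RintegralZl//; apply: continuous_integ => //.
apply: Rintegral_mpow_continuous => //.
apply: (@pm_comp_continuous _ _ _ _ _ pmP _ _ (fun p : V * r.-tuple V => [tuple of p.1 :: p.2]) r1).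
exact: cons_pair_continuous.
Qed.

Section bounds.
Context (H : uniform_hypergraph V K).
Context (P_dep : forall s, (size s <= N)%N -> ~ independent H [fset x in s]%fset -> P s = 0).

Lemma dual_fun_edges c v : edge_tuples H v -> dual_fun c v = 0.
Proof.
move=> Ev; rewrite /dual_fun /extend_avg.
under eq_Rintegral => w _.
  rewrite P_dep; last 2 first.
  - by rewrite size_cat !size_tuple addn1.
  - move=> h; apply: h; exists [fset x in (v : seq V)]%fset => //.
    by apply/fsubsetP => z; rewrite !inE => ->.
  over.
by rewrite Rintegral_cst// mul0r mulr0.
Qed.

(** The feasible point is normalized by its trace m (k+r+1), where the edges
    have k + 2 elements; its value is then the ratio of two consecutive
    moments. *)
Lemma moment_le_theta_big : 0 < m 1 ->
  ((m 1)%:E <= theta_big mu H (polya_dual_c mu K r))%E.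
Proof.
move=> m1.
have gt0 j : (j <= N)%N -> 0 < m j by move=> jN; exact: (moment_gt0 cV pmP).
have kr : 0 < m (k + r).+1 by apply: gt0; rewrite !addSn addn1 ltnS leqW.
pose c := (m (k + r).+1)^-1.
have c0 : 0 <= c by rewrite invr_ge0 ltW.
have Afeas : theta_big_feasible mu H (polya_dual_c mu K r) (dual_fun c).
  split.
  - exact: dual_fun_polya_dual.
  - exact: dual_fun_slice_positive.
  - by move=> v; exact: dual_fun_edges.
  - have cK := slice_average_kernel c0.
    split; first exact: mercer_trace_class.
    have := @mercer_trace _ _ _ cV mu _ cK.
    by rewrite dual_fun_trace mulVf// gt_eqF.
apply: (@le_trans _ _ (c * m (K + r))%:E).
  rewrite lee_fin /c mulrC ler_pdivlMr//.
  apply: (moment_step cV pmP) => //.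
  by rewrite addn1 !addSn.
rewrite /theta_big le_max; apply/orP; right.
by apply: ereal_sup_ubound; exists (dual_fun c) => //; rewrite dual_fun_total.
Qed.

(** The feasible point is normalized by its diagonal m (r+1); its value is a
    product of k + 1 ratios of consecutive moments, each at least m 1. *)
Lemma moment_le_theta_small : 0 < m 1 ->
  ((m 1)%:E <= theta_small mu H (polya_dual_c mu K r) `^ (K.-1%:R^-1))%E.
Proof.
move=> m1.
have gt0 j : (j <= N)%N -> 0 < m j by move=> jN; exact: (moment_gt0 cV pmP).
have r1 : 0 < m r.+1 by apply: gt0; rewrite addn1 ltnS leq_addl.
pose c := (m r.+1)^-1.
have c0 : 0 <= c by rewrite invr_ge0 ltW.
have Afeas : theta_small_feasible mu H (polya_dual_c mu K r) (dual_fun c).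
  split.
  - exact: dual_fun_polya_dual.
  - exact: dual_fun_slice_positive.
  - by move=> v; exact: dual_fun_edges.
  - by rewrite dual_fun_diag mulVf// gt_eqF.
have le_theta : ((m 1 ^+ K.-1)%:E <= theta_small mu H (polya_dual_c mu K r))%E.
  apply: (@le_trans _ _ (c * m (K + r))%:E).
    rewrite lee_fin /c mulrC ler_pdivlMr//.
    have -> : (K + r = r.+1 + K.-1)%N by rewrite /= addSnnS addnC.
    apply: (moment_pow cV pmP) => //.
    by rewrite /= addSnnS addnC addn1.
  rewrite /theta_small le_max; apply/orP; right.
  by apply: ereal_sup_ubound; exists (dual_fun c) => //; rewrite dual_fun_total.
have -> : (m 1)%:E = ((m 1 ^+ K.-1)%:E `^ (K.-1%:R^-1))%E.
  rewrite poweR_EFin -powR_mulrn ?ltW// -powRrM mulfV ?powRr1 ?ltW//.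
  by rewrite pnatr_eq0.
apply: gt0_ler_poweR => //.
- by rewrite in_itv/= leey lee_fin exprn_ge0// ltW.
- by rewrite in_itv/= leey/= andbT; apply: le_trans le_theta; rewrite lee_fin exprn_ge0// ltW.
Qed.

End bounds.

End dual_function.

(** * From functions on subset spaces to pseudo-moments *)

Section subset_functions.
Context (V : choiceType).

Lemma val_to_SubSp n (S : {fset V}) : (#|` S| <= n)%N -> val (to_SubSp n S) = S.
Proof. by move=> h; rewrite /to_SubSp insubdK. Qed.

Lemma card_fset_seq_le (s : seq V) : (#|` [fset x in s]%fset| <= size s)%N.
Proof. by rewrite card_fseq size_undup. Qed.

Lemma independentS k (H : uniform_hypergraph V k) (S T : {fset V}) :
  (S `<=` T)%fset -> independent H T -> independent H S.
Proof. by move=> ST iT [e He eS]; apply: iT; exists e => //; exact: fsubset_trans ST. Qed.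

Definition seq_eval (R : Type) n (phi : SubSp V n -> R) (s : seq V) : R :=
  phi (to_SubSp n [fset x in s]%fset).

Lemma seq_eval_eq (R : Type) n (phi : SubSp V n -> R) s t : s =i t ->
  seq_eval phi s = seq_eval phi t.
Proof.
by move=> st; congr (phi (to_SubSp n _)); apply/fsetP => z; rewrite !inE st.
Qed.

Lemma fset_cat (s t : seq V) : [fset x in s ++ t]%fset = ([fset x in s] `|` [fset x in t])%fset.
Proof. by apply/fsetP => z; rewrite !inE. Qed.

End subset_functions.

Section quotient_continuity.
Context (V : topologicalType) (R : realType).

Lemma tuple_to_SubSp_continuous n : continuous (@tuple_to_SubSp V n).
Proof. by apply/continuousP => U oU. Qed.

(** The universal property of the quotient topology. *)
Lemma SubSp_continuous (X : topologicalType) n (f : SubSp V n -> X) :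
  continuous (f \o @tuple_to_SubSp V n) -> continuous f.
Proof. by move=> /continuousP cf; apply/continuousP => U /cf. Qed.

(** A tuple of length n > 0 is padded to length N by repeating its first
    entry, which changes neither its set of entries nor the continuity. *)
Lemma seq_eval_continuous N n (phi : SubSp V N -> R) : continuous phi ->
  (n <= N)%N -> continuous (fun u : n.-tuple V => seq_eval phi u).
Proof.
move=> cphi; case: n => [_|n nN].
  have -> : (fun u : 0.-tuple V => seq_eval phi u) = (fun=> seq_eval phi [::]).
    by apply/funext => u; rewrite (tuple0 u).
  exact: cst_continuous.
pose pad (u : n.+1.-tuple V) : N.-tuple V := [tuple tnth u (inord i) | i < N].
have -> : (fun u : n.+1.-tuple V => seq_eval phi u) =
    phi \o (@tuple_to_SubSp V N \o pad).
  apply/funext => u; apply: seq_eval_eq => z; apply/tnthP/tnthP => -[i ->].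
    exists (widen_ord nN i); rewrite tnth_mktuple; congr (tnth u _).
    by apply: val_inj; rewrite /= inordK.
  by exists (inord i); rewrite tnth_mktuple.
move=> u; apply: continuous_comp; last exact: cphi.
apply: continuous_comp; last exact: tuple_to_SubSp_continuous.
exact: reindex_continuous.
Qed.

End quotient_continuity.

Section hierarchies.
Context (R : realType) d (V : borelType d).
Context (mu : {finite_measure set V -> \bar R}).

Lemma card_fset_opt_seq (a : option V) : (#|` [fset x in opt_seq a]%fset| <= 1)%N.
Proof. by apply: (leq_trans (card_fset_seq_le _)); case: a. Qed.

(** If the entries of q form a dependent set, all sets in the kernel are
    dependent and it vanishes. *)
Lemma block_feasible_psd k (H : uniform_hypergraph V k) n (phi : SubSp V n -> R) q :
  block_moment_feasible H phi -> (size q + 2 <= n)%N ->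
  psd_kernel (fun a b : option V => seq_eval phi (q ++ opt_seq a ++ opt_seq b)).
Proof.
move=> [cphi phi0 phi_dep phi_psd] qn.
have qn2 : (#|` [fset x in q]%fset| <= n - 2)%N.
  apply: (leq_trans (card_fset_seq_le q)); rewrite -(leq_add2r 2) subnK//.
  exact: leq_trans (leq_addl _ _) qn.
have [iQ|nQ] := pselect (independent H [fset x in q]%fset).
  have := phi_psd (to_SubSp _ [fset x in q]%fset); rewrite val_to_SubSp// => /(_ iQ).
  move=> /(psd_comp (fun a : option V => to_SubSp 1 [fset x in opt_seq a]%fset)).
  congr psd_kernel; apply/funext => a; apply/funext => b.
  rewrite !val_to_SubSp ?card_fset_opt_seq//; congr (phi (to_SubSp _ _)).
  by rewrite !fset_cat fsetUA.
move=> m x c; rewrite big1// => i _; rewrite big1// => j _.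
rewrite /seq_eval phi_dep ?mulr0// val_to_SubSp.
  by move=> h; apply: nQ; apply: independentS h; rewrite fset_cat fsubsetUl.
apply: (leq_trans (card_fset_seq_le _)); rewrite !size_cat; apply: leq_trans qn.
by rewrite leq_add2l -[2%N]/(1 + 1)%N leq_add//; [case: (x i)|case: (x j)].
Qed.

Lemma block_feasible_pseudo_moments k (H : uniform_hypergraph V k) n (phi : SubSp V n -> R) :
  block_moment_feasible H phi -> pseudo_moments n (seq_eval phi).
Proof.
move=> fphi; have [cphi phi0 _ _] := fphi; split.
- exact: seq_eval_eq.
- by move=> j jn; exact: seq_eval_continuous.
- by move=> q; exact: block_feasible_psd fphi.
- by rewrite -phi0; congr (phi (to_SubSp _ _)); apply/fsetP => z; rewrite !inE.
Qed.

(** Restrict phi to the sets with at most n + 1 elements. The kernel of the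
    block hierarchy at Q is the restriction of the moment kernel to the sets
    Q, Q + x. *)
Lemma momentM_le_blockM k (H : uniform_hypergraph V k) n : (1 < n)%N ->
  (momentM mu H n <= blockM mu H (n + 1))%E.
Proof.
move=> n1; apply: ge_ereal_sup => _ [phi [cphi phi0 phi_dep phi_psd] <-].
have nn : (n + 1 <= 2 * n)%N by rewrite mul2n -addnn leq_add2l ltnW.
apply: ereal_sup_ubound.
pose psi (S : SubSp V (n + 1)) := phi (to_SubSp _ (val S)).
have cardS (S : SubSp V (n + 1)) : (#|` val S| <= 2 * n)%N by exact: leq_trans (valP S) nn.
exists psi; last first.
  congr (_%:E); apply: eq_Rintegral => x _; rewrite /psi val_to_SubSp//.
  by rewrite cardfs1 addn1.
split.
- apply: SubSp_continuous.
  have -> : psi \o @tuple_to_SubSp V (n + 1) =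
      (fun u : (n + 1).-tuple V => seq_eval phi u); last exact: seq_eval_continuous.
  apply/funext => u; rewrite /psi /= /tuple_to_SubSp val_to_SubSp//.
  by apply: (leq_trans (card_fset_seq_le _)); rewrite size_tuple.
- by rewrite /psi val_to_SubSp ?cardfs0.
- by move=> S nS; apply: phi_dep; rewrite val_to_SubSp.
- move=> Q _.
  have cQ (S : SubSp V 1) : (#|` val Q `|` val S|%fset <= n)%N.
    apply: (leq_trans (leq_card_fsetU _ _)); apply: leq_trans (leq_add (valP Q) (valP S)) _.
    by rewrite !addn1 subSS subn1 prednK// ltnW.
  have := psd_comp (fun S : SubSp V 1 => to_SubSp n (val Q `|` val S)%fset) phi_psd.
  congr psd_kernel; apply/funext => S; apply/funext => T.
  rewrite !val_to_SubSp//.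
    rewrite /psi val_to_SubSp.
      by congr (phi (to_SubSp _ _)); rewrite fsetUACA fsetUid fsetUA.
    apply: (leq_trans (leq_card_fsetU _ _)).
    by apply: leq_add; [exact: cQ|exact: (valP T)].
Qed.

End hierarchies.

Theorem theorem5p2 (R : realType) (d : measure_display) (V : borelType d)
    (V_compact : compact [set: V]) (V_hausdorff : hausdorff_space V)
    (mu : {finite_measure set V -> \bar R})
    (k : nat) (k_ge2 : (2 <= k)%N)
    (H : uniform_hypergraph V k) (E_measurable : measurable (edge_tuples H))
    (r : nat) (r_ge1 : (1 <= r)%N) :
  ((momentM mu H (k + r) <= blockM mu H (k + r + 1))%E /\
   (blockM mu H (k + r + 1) <=
      theta_small mu H (polya_dual_c mu k r) `^ (k.-1%:R^-1))%E) /\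
  ((momentM mu H (k + r) <= blockM mu H (k + r + 1))%E /\
   (blockM mu H (k + r + 1) <= theta_big mu H (polya_dual_c mu k r))%E).
Proof.
have MB : (momentM mu H (k + r) <= blockM mu H (k + r + 1))%E.
  apply: momentM_le_blockM; exact: ltn_addr.
case: k k_ge2 H E_measurable MB => [//|[//|k]] _ H _ MB.
have key (phi : SubSp V (k.+2 + r + 1) -> R) : block_moment_feasible H phi ->
    0 < \int[mu]_x phi (to_SubSp _ [fset x]%fset) ->
    ((\int[mu]_x phi (to_SubSp _ [fset x]%fset))%:E <=
       theta_small mu H (polya_dual_c mu k.+2 r) `^ (k.+2.-1%:R^-1))%E /\
    ((\int[mu]_x phi (to_SubSp _ [fset x]%fset))%:E <=
       theta_big mu H (polya_dual_c mu k.+2 r))%E.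
  move=> fphi; have [cphi phi0 phi_dep _] := fphi.
  have pmP := block_feasible_pseudo_moments fphi.
  have P_dep s : (size s <= k.+2 + r + 1)%N ->
      ~ independent H [fset x in s]%fset -> seq_eval phi s = 0.
    move=> sN ns; apply: phi_dep; rewrite val_to_SubSp//.
    exact: leq_trans (card_fset_seq_le s) sN.
  have -> : \int[mu]_x phi (to_SubSp _ [fset x]%fset) = moment mu (seq_eval phi) 1.
    rewrite (moment1 V_compact mu pmP)// ?addn1//.
    apply: eq_Rintegral => x _; congr (phi (to_SubSp _ _)).
    by apply/fsetP => z; rewrite !inE orbF.
  move=> m1; split.
    exact: (moment_le_theta_small V_compact pmP P_dep).
  exact: (moment_le_theta_big V_compact pmP P_dep).
split; split=> //; apply: ge_ereal_sup => _ [phi fphi <-].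
  have [m1|m1] := ltP 0 (\int[mu]_x phi (to_SubSp _ [fset x]%fset)).
    by have [] := key phi fphi m1.
  by apply: le_trans (poweR_ge0 _ _); rewrite lee_fin.
have [m1|m1] := ltP 0 (\int[mu]_x phi (to_SubSp _ [fset x]%fset)).
  by have [] := key phi fphi m1.
apply: (@le_trans _ _ 0%E); first by rewrite lee_fin.
by rewrite /theta_big le_max lexx.
Qed.
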